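(* Let $r\in(0,1)$ and let $\varphi_r(z)=\frac{z+r}{1+rz}$ be the corresponding hyperbolic automorphism of the unit disc $\mathbb{D}$. Let $C_{\varphi_r}f=f\circ\varphi_r$ be the composition operator on $S^2(\mathbb{D})$ and $C_{\varphi_r}^*$ its Hilbert space adjoint. Then $C_{\varphi_r}^*-\overline{\lambda}I$ is universal on $S^2(\mathbb{D})$ for every $\lambda\in\mathcal{A}_r$, where \[ \mathcal{A}_r=\Big\{\lambda\in\mathbb{C}:\Big(\frac{1-r}{1+r}\Big)^{1/2}<|\lambda|<\Big(\frac{1-r}{1+r}\Big)^{-1/2}\Big\}. \]
   Context: $S^2(\mathbb{D})$ is the Hilbert space of analytic functions $f:\mathbb{D}\to\mathbb{C}$ with $f'$ in the Hardy space $H^2(\mathbb{D})$, normed by $\|f\|^2=|f(0)|^2+\|f'\|_{H^2}^2$ (equivalently, for $f=\sum a_nz^n$, a norm equivalent to $(\sum_n |a_n|^2(n+1)^2)^{1/2}$). $C_{\varphi_r}$ is bounded on $S^2(\mathbb{D})$. For a separable infinite-dimensional Hilbert space $H$, operators $T_1,T_2$ are similar if $T_1=J^{-1}T_2J$ for a linear isomorphism $J$; $U\in\mathcal{L}(H)$ is universal if for every $T\in\mathcal{L}(H)$ there exist a closed $U$-invariant subspace $M\subset H$ and $c\neq0$ such that $U|_M$ is similar to $cT$. *)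

(* Defs.v *)
From Stdlib Require Import Reals Lra.
From Coquelicot Require Import Coquelicot.
Open Scope R_scope.

(* Elements of S^2(D) are represented by their Taylor coefficient sequences
   f(z) = sum_n a n z^n. *)
Definition seqC := nat -> C.

(* weights: ||f||^2 = |f(0)|^2 + ||f'||_{H^2}^2 = |a_0|^2 + sum_{n>=1} n^2 |a_n|^2 *)
Definition wS2 (n : nat) : R := match n with O => 1 | _ => (INR n)^2 end.

Definition inS2 (a : seqC) : Prop :=
  ex_series (fun n => wS2 n * (Cmod (a n))^2).

Definition normS2 (a : seqC) : R :=
  sqrt (Series (fun n => wS2 n * (Cmod (a n))^2)).

Definition ipS2 (a b : seqC) : C :=
  let s := fun n => Cmult (RtoC (wS2 n)) (Cmult (a n) (Cconj (b n))) in
  (Series (fun n => Re (s n)), Series (fun n => Im (s n))).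

Definition addS (a b : seqC) : seqC := fun n => Cplus (a n) (b n).
Definition scalS (c : C) (a : seqC) : seqC := fun n => Cmult c (a n).
Definition subS (a b : seqC) : seqC := fun n => Cminus (a n) (b n).
Definition zeroS : seqC := fun _ => RtoC 0.

(* (possibly partially defined) operators; only their action on S^2 matters *)
Definition op := seqC -> seqC.

Definition phi (r : R) (z : C) : C :=
  Cdiv (Cplus z (RtoC r)) (Cplus (RtoC 1) (Cmult (RtoC r) z)).

Definition is_comp_op (r : R) (Cop : op) : Prop :=
  forall a, inS2 a ->
    inS2 (Cop a) /\
    forall z : C, Cmod z < 1 ->
      forall v : C, is_series (fun n => Cmult (a n) (Cpow (phi r z) n)) v ->
        is_series (fun n => Cmult (Cop a n) (Cpow z n)) v.

Definition is_adjoint (T A : op) : Prop :=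
  (forall b, inS2 b -> inS2 (A b)) /\
  forall a b, inS2 a -> inS2 b -> ipS2 (T a) b = ipS2 a (A b).

Definition bounded_op (T : op) : Prop :=
  (forall a, inS2 a -> inS2 (T a)) /\
  (forall a b, inS2 a -> inS2 b -> T (addS a b) = addS (T a) (T b)) /\
  (forall c a, inS2 a -> T (scalS c a) = scalS c (T a)) /\
  exists K : R, forall a, inS2 a -> normS2 (T a) <= K * normS2 a.

Definition closed_subspace (M : seqC -> Prop) : Prop :=
  (forall a, M a -> inS2 a) /\
  M zeroS /\
  (forall a b, M a -> M b -> M (addS a b)) /\
  (forall c a, M a -> M (scalS c a)) /\
  (forall (u : nat -> seqC) (a : seqC), (forall k, M (u k)) -> inS2 a ->
     is_lim_seq (fun k => normS2 (subS (u k) a)) 0 -> M a).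

Definition invariant (U : op) (M : seqC -> Prop) : Prop :=
  forall a, M a -> M (U a).

Definition lin_iso_onto_S2 (M : seqC -> Prop) (J : op) : Prop :=
  (forall a, M a -> inS2 (J a)) /\
  (forall a b, M a -> M b -> J (addS a b) = addS (J a) (J b)) /\
  (forall c a, M a -> J (scalS c a) = scalS c (J a)) /\
  (exists K : R, forall a, M a -> normS2 (J a) <= K * normS2 a) /\
  (exists k : R, 0 < k /\ forall a, M a -> k * normS2 a <= normS2 (J a)) /\
  (forall b, inS2 b -> exists a, M a /\ J a = b).

Definition universal (U : op) : Prop :=
  forall T : op, bounded_op T ->
    exists (M : seqC -> Prop) (c : C) (J : op),
      c <> RtoC 0 /\ closed_subspace M /\ invariant U M /\
      lin_iso_onto_S2 M J /\
      forall a, M a -> J (U a) = scalS c (T (J a)).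

Definition shift_op (A : op) (lam : C) : op :=
  fun a => subS (A a) (scalS (Cconj lam) a).

(* Main.v *)
(** The functionals on [S^2] that kill the constants form a copy of [H^2] modulo constants: a
    sequence [g] in [l^2] acts through the element [(0, g_n / n)] of [S^2], and under this
    identification the adjoint of [C_phi_r] becomes [C_phi] with [phi = phi_(-r)].  So let
    [C = C_phi] act on [H^2] and let [W] be its unitary normalisation,
    [W f = sqrt (1 - r^2) / (1 - r z) * (f o phi)].  With [kap = sqrt ((1 - r) / (1 + r))] and with
    [P], [M] the multiplications by [1 + z] and [1 - z], one has the exact intertwinings
    [C P = kap P W] and [C M = kap^-1 M W].  For [kap < |lam| < kap^-1] both
    [kap W - lam] and [kap^-1 W - lam] are invertible by Neumann series, with inverses [R1], [R2].
    Hence [(P R1 + M R2) / 2] is a right inverse of [C - lam], and [P R1 M - M R2 P] maps into its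
    kernel.  The latter map is non-zero, as one sees by applying it to [(1 - z^2)^j], [j] large, and
    evaluating at [0].  Since [C] is the square of the analogous operator for a smaller [r], the
    kernel is infinite-dimensional.  Finally (Caradus), if [V] is a right inverse of [U = C - lam]
    and [S] embeds [l^2] isometrically in [ker U], then [X = sum_k c^k V^k S T^k] satisfies
    [U X = c X T] and is bounded below for small [c], so [U] restricted to the range of [X] is
    similar to [c T]. *)

Require Import Defs.
From Stdlib Require Import Reals Lra Lia FunctionalExtensionality ClassicalEpsilon List.
From Coquelicot Require Import Coquelicot.
Open Scope R_scope.

(** The factors [1 + z] and [1 - z] come from the two fixed points -1 and 1 of the automorphism:
    each factor vanishes at one of them, so composition reproduces it up to the weight of [W] and a
    constant. Analytic identities are checked at the real points of (-1, 1) only: there they become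
    rational identities between real numbers, and the values on the segment determine the Taylor
    coefficients. No boundary integral occurs. That [W] is a contraction comes from a finite
    identity between coefficients, and the duality between [S^2] and [H^2] is a matrix identity
    proved by recurrence. The obstacle near the end is that the model lives on [H^2] modulo
    constants, so the lower bound for [X] has to survive the deletion of the coefficient of index 0.
    For this reason the kernel vectors used by [S] are chosen to vanish at 0. *)

(** * The space l^2 and bounded operators on it *)

(* Norms are handled through upper bounds only, so no estimate depends on the junk value of
   [Series] at a divergent series. *)
Definition normle (f : seqC) (B : R) : Prop :=
  0 <= B /\ forall N, sum_n (fun n => (Cmod (f n))^2) N <= B^2.

Definition l2 (f : seqC) : Prop := exists B, normle f B.

Lemma sum_n_S (u : nat -> R) N : sum_n u (S N) = sum_n u N + u (S N).
Proof. now rewrite sum_Sn. Qed.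

Lemma sum_n_0 (u : nat -> R) : sum_n u 0 = u 0%nat.
Proof. now rewrite sum_O. Qed.

Lemma Cmod_sqr (z : C) : Cmod z ^ 2 = fst z ^ 2 + snd z ^ 2.
Proof.
  unfold Cmod. rewrite pow2_sqrt; [reflexivity|]. nra.
Qed.

Lemma seq_ext (f g : seqC) : (forall n, f n = g n) -> f = g.
Proof. intros; now apply functional_extensionality. Qed.

Lemma sum_n_pos_ge (u : nat -> R) N : (forall n, 0 <= u n) -> u N <= sum_n u N.
Proof.
  intros Hu. assert (H : forall N, 0 <= sum_n u N).
  { intros n; induction n; rewrite ?sum_n_0, ?sum_n_S; auto.
    specialize (Hu (S n)); lra. }
  destruct N; rewrite ?sum_n_0, ?sum_n_S; [lra|]. specialize (H N); lra.
Qed.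

Lemma normle_coord f B n : normle f B -> Cmod (f n) <= B.
Proof.
  intros [HB H].
  assert (H1 := sum_n_pos_ge (fun n => (Cmod (f n))^2) n (fun n => pow2_ge_0 _)).
  specialize (H n). cbv beta in H1.
  apply Rsqr_incr_0_var; auto. unfold Rsqr. simpl in *. lra.
Qed.

Lemma normle_mono f A B : normle f A -> A <= B -> normle f B.
Proof.
  intros [H0 H] HAB; split; [lra|]. intros N; specialize (H N). nra.
Qed.

Lemma normle_eps f B : (forall eps, 0 < eps -> normle f (B + eps)) -> 0 <= B -> normle f B.
Proof.
  intros H HB; split; auto. intros N. apply le_epsilon. intros e He.
  (* Since [d <= 1], one has [(B + d)^2 - B^2 = d (2 B + d) <= d (2 B + 1) <= e]. *)
  set (d := Rmin 1 (e / (2 * B + 1))).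
  assert (0 < e / (2 * B + 1)) by (apply Rdiv_lt_0_compat; lra).
  assert (Hd : 0 < d) by (unfold d; apply Rmin_pos; lra).
  destruct (H d Hd) as [_ H1]. specialize (H1 N).
  assert (d <= 1) by apply Rmin_l.
  assert (d <= e / (2 * B + 1)) by apply Rmin_r.
  assert (d * (2 * B + 1) <= e).
  { apply Rmult_le_reg_r with (/ (2 * B + 1)). apply Rinv_0_lt_compat; lra.
    field_simplify; [|lra|lra]. unfold Rdiv in *. lra. }
  nra.
Qed.

Lemma sum_n_linear_le (u v t : nat -> R) p q N :
  (forall n, t n <= p * u n + q * v n) ->
  sum_n t N <= p * sum_n u N + q * sum_n v N.
Proof.
  intros H. induction N; rewrite ?sum_n_0, ?sum_n_S; [auto|].
  specialize (H (S N)). lra.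
Qed.

(** Minkowski without Cauchy-Schwarz: [(p + q)^2 <= (1 + B/A) p^2 + (1 + A/B) q^2] holds termwise,
    and these weights sum to exactly [(A + B)^2]. Positive [A] and [B] are obtained by adding an
    epsilon. *)
Lemma normle_add f g A B : normle f A -> normle g B -> normle (addS f g) (A + B).
Proof.
  assert (H : forall A B, 0 < A -> 0 < B -> normle f A -> normle g B -> normle (addS f g) (A + B)).
  { clear. intros A B HA HB [_ Hf] [_ Hg]. split; [lra|]. intros N.
    apply Rle_trans with ((1 + B / A) * sum_n (fun n => Cmod (f n) ^ 2) N +
      (1 + A / B) * sum_n (fun n => Cmod (g n) ^ 2) N).
    - apply sum_n_linear_le. intros n. unfold addS.
      assert (Ht := Cmod_triangle (f n) (g n)).
      assert (Cmod (f n + g n) ^ 2 <= (Cmod (f n) + Cmod (g n)) ^ 2).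
      { apply pow_incr. split; auto. apply Cmod_ge_0. }
      apply Rle_trans with (1 := H).
      set (p := Cmod (f n)). set (q := Cmod (g n)).
      assert (E : (1 + B / A) * p ^ 2 + (1 + A / B) * q ^ 2 - (p + q)^2 =
        (B * p - A * q) ^ 2 * / (A * B)) by (field; lra).
      assert (0 <= (B * p - A * q) ^ 2 * / (A * B)).
      { apply Rmult_le_pos. apply pow2_ge_0. left. apply Rinv_0_lt_compat. nra. }
      lra.
    - replace ((A + B)^2) with ((1 + B / A) * A^2 + (1 + A / B) * B^2) by (field; lra).
      apply Rplus_le_compat; apply Rmult_le_compat_l; auto;
      [assert (0 < B / A) | assert (0 < A / B)]; try lra; now apply Rdiv_lt_0_compat. }
  intros Hf Hg. assert (HA := proj1 Hf). assert (HB := proj1 Hg).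
  apply normle_eps; [|lra]. intros e He.
  replace (A + B + e) with ((A + e / 2) + (B + e / 2)) by lra.
  apply H; try lra; [apply normle_mono with A | apply normle_mono with B]; auto; lra.
Qed.

Lemma normle_scal c f B : normle f B -> normle (scalS c f) (Cmod c * B).
Proof.
  intros [HB H]. assert (Hc := Cmod_ge_0 c). split; [nra|]. intros N.
  apply Rle_trans with (Cmod c ^ 2 * sum_n (fun n => Cmod (f n) ^ 2) N +
     0 * sum_n (fun n => Cmod (f n) ^ 2) N).
  - apply sum_n_linear_le. intros n. unfold scalS. rewrite Cmod_mult. lra.
  - specialize (H N). assert (0 <= Cmod c ^ 2) by apply pow2_ge_0. nra.
Qed.

Lemma subS_add f g : subS f g = addS f (scalS (-1) g).
Proof. apply seq_ext; intros n. unfold subS, addS, scalS. ring. Qed.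

Lemma normle_sub f g A B : normle f A -> normle g B -> normle (subS f g) (A + B).
Proof.
  intros Hf Hg. rewrite subS_add. apply normle_add; auto.
  replace B with (Cmod (-1) * B). now apply normle_scal.
  rewrite Cmod_R. rewrite Rabs_left; lra.
Qed.

Lemma normle_zero : normle zeroS 0.
Proof.
  split; [lra|]. intros N. unfold zeroS.
  assert (E : sum_n (fun _ : nat => Cmod 0 ^ 2) N = 0); [|lra].
  rewrite Cmod_0. induction N; rewrite ?sum_n_0, ?sum_n_S, ?IHN; simpl; lra.
Qed.

Lemma normle_0_eq f : normle f 0 -> f = zeroS.
Proof.
  intros H. apply seq_ext; intros n. apply Cmod_eq_0.
  assert (Hn := normle_coord f 0 n H). assert (Hp := Cmod_ge_0 (f n)). lra.
Qed.

Lemma l2_add f g : l2 f -> l2 g -> l2 (addS f g).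
Proof. intros [A Hf] [B Hg]. exists (A + B). now apply normle_add. Qed.
Lemma l2_sub f g : l2 f -> l2 g -> l2 (subS f g).
Proof. intros [A Hf] [B Hg]. exists (A + B). now apply normle_sub. Qed.
Lemma l2_scal c f : l2 f -> l2 (scalS c f).
Proof. intros [A Hf]. exists (Cmod c * A). now apply normle_scal. Qed.
Lemma l2_zero : l2 zeroS.
Proof. exists 0. apply normle_zero. Qed.

Definition linear_l2 (T : op) : Prop :=
  (forall f g, l2 f -> l2 g -> T (addS f g) = addS (T f) (T g)) /\
  (forall c f, l2 f -> T (scalS c f) = scalS c (T f)).

Definition bounded_l2 (T : op) (K : R) : Prop :=
  linear_l2 T /\ 0 <= K /\ forall f B, normle f B -> normle (T f) (K * B).

Lemma bounded_maps_l2 T K f : bounded_l2 T K -> l2 f -> l2 (T f).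
Proof. intros (_ & _ & H) [B Hf]. exists (K * B). now apply H. Qed.

Lemma linear_sub T f g : linear_l2 T -> l2 f -> l2 g -> T (subS f g) = subS (T f) (T g).
Proof.
  intros [Ha Hs] Hf Hg. rewrite !subS_add, Ha, Hs; auto. now apply l2_scal.
Qed.

Lemma linear_zero T : linear_l2 T -> T zeroS = zeroS.
Proof.
  intros [_ Hs].
  assert (E : forall g, scalS 0 g = zeroS).
  { intros g. apply seq_ext; intros n. unfold scalS, zeroS. ring. }
  rewrite <- (E zeroS) at 1. rewrite Hs by apply l2_zero. apply E.
Qed.

Lemma bounded_comp T1 T2 K1 K2 : bounded_l2 T1 K1 -> bounded_l2 T2 K2 ->
  bounded_l2 (fun f => T1 (T2 f)) (K1 * K2).
Proof.
  intros H1 H2. assert (L2 := fun f => bounded_maps_l2 T2 K2 f H2).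
  destruct H1 as ([A1 S1] & P1 & B1), H2 as ([A2 S2] & P2 & B2).
  split; [split|split].
  - intros. rewrite A2, A1; auto.
  - intros. rewrite S2, S1; auto.
  - nra.
  - intros. rewrite Rmult_assoc. auto.
Qed.

Lemma bounded_add T1 T2 K1 K2 : bounded_l2 T1 K1 -> bounded_l2 T2 K2 ->
  bounded_l2 (fun f => addS (T1 f) (T2 f)) (K1 + K2).
Proof.
  intros ([A1 S1] & P1 & B1) ([A2 S2] & P2 & B2).
  split; [split|split].
  - intros. rewrite A2, A1; auto. apply seq_ext; intros; unfold addS; ring.
  - intros. rewrite S2, S1; auto. apply seq_ext; intros; unfold addS, scalS; ring.
  - lra.
  - intros. rewrite Rmult_plus_distr_r. apply normle_add; auto.
Qed.

Lemma bounded_scal c T K : bounded_l2 T K -> bounded_l2 (fun f => scalS c (T f)) (Cmod c * K).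
Proof.
  intros ([A1 S1] & P1 & B1). assert (Hc := Cmod_ge_0 c).
  split; [split|split].
  - intros. rewrite A1; auto. apply seq_ext; intros; unfold addS, scalS; ring.
  - intros. rewrite S1; auto. apply seq_ext; intros; unfold scalS; ring.
  - nra.
  - intros. rewrite Rmult_assoc. apply normle_scal; auto.
Qed.

Lemma bounded_id : bounded_l2 (fun f => f) 1.
Proof.
  repeat split; auto; try lra. rewrite Rmult_1_l; apply H. intros N. rewrite Rmult_1_l. apply H.
Qed.

(** * Convergence and completeness in l^2 *)

Definition conv (s : nat -> seqC) (l : seqC) : Prop :=
  forall eps, 0 < eps -> exists N, forall n, (N <= n)%nat -> normle (subS (s n) l) eps.

Lemma conv_unique s l l' : conv s l -> conv s l' -> l = l'.
Proof.
  intros H H'. assert (E : subS l l' = zeroS).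
  { apply normle_0_eq. apply normle_eps; [|lra]. intros e He.
    destruct (H (e/2)) as [N HN]; [lra|]. destruct (H' (e/2)) as [N' HN']; [lra|].
    specialize (HN (max N N') ltac:(lia)). specialize (HN' (max N N') ltac:(lia)).
    assert (HH := normle_sub _ _ _ _ HN' HN).
    replace (0 + e) with (e/2 + e/2) by lra.
    replace (subS l l') with (subS (subS (s (max N N')) l') (subS (s (max N N')) l)); auto.
    apply seq_ext; intros; unfold subS; ring. }
  apply seq_ext; intros n. apply (f_equal (fun f => f n)) in E. unfold subS, zeroS in E.
  replace (l n) with (l n - l' n + l' n)%C by ring. rewrite E. ring.
Qed.

Lemma conv_ext s s' l : (forall n, s n = s' n) -> conv s l -> conv s' l.
Proof. intros E H e He. destruct (H e He) as [N HN]. exists N. intros; rewrite <- E; auto. Qed.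

Lemma conv_add s l s' l' : conv s l -> conv s' l' ->
  conv (fun n => addS (s n) (s' n)) (addS l l').
Proof.
  intros H H' e He.
  destruct (H (e/2)) as [N HN]; [lra|]. destruct (H' (e/2)) as [N' HN']; [lra|].
  exists (max N N'). intros n Hn.
  specialize (HN n ltac:(lia)). specialize (HN' n ltac:(lia)).
  replace e with (e/2+e/2) by lra.
  replace (subS (addS (s n) (s' n)) (addS l l')) with (addS (subS (s n) l) (subS (s' n) l')).
  now apply normle_add. apply seq_ext; intros; unfold subS, addS; ring.
Qed.

Lemma conv_l2 s l : (forall n, l2 (s n)) -> conv s l -> l2 l.
Proof.
  intros Hs H. destruct (H 1) as [N HN]; [lra|]. specialize (HN N (le_n N)).
  replace l with (subS (s N) (subS (s N) l)). apply l2_sub; auto. now exists 1.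
  apply seq_ext; intros; unfold subS; ring.
Qed.

Lemma conv_bounded T K s l : bounded_l2 T K -> (forall n, l2 (s n)) -> conv s l ->
  conv (fun n => T (s n)) (T l).
Proof.
  intros HT Hs H e He. assert (Hl := conv_l2 s l Hs H).
  destruct HT as (HL & HK & HB).
  destruct (H (e / (K + 1))) as [N HN]. apply Rdiv_lt_0_compat; lra.
  exists N. intros n Hn. rewrite <- linear_sub; auto.
  apply normle_mono with (K * (e / (K + 1))). auto.
  replace e with ((K + 1) * (e / (K+1))) at 2 by (field; lra).
  apply Rmult_le_compat_r; [|lra]. left; apply Rdiv_lt_0_compat; lra.
Qed.

Lemma conv_normle s l B : conv s l -> (forall n, normle (s n) B) -> normle l B.
Proof.
  intros H Hs. apply normle_eps; [|apply (Hs 0%nat)]. intros e He.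
  destruct (H e He) as [N HN]. specialize (HN N (le_n N)).
  replace l with (subS (s N) (subS (s N) l)). apply normle_sub; auto.
  apply seq_ext; intros; unfold subS; ring.
Qed.

Lemma conv_scal c s l : conv s l -> conv (fun n => scalS c (s n)) (scalS c l).
Proof.
  intros H e He. assert (Hc := Cmod_ge_0 c).
  destruct (H (e / (Cmod c + 1))) as [N HN]. apply Rdiv_lt_0_compat; lra.
  exists N. intros n Hn.
  replace (subS (scalS c (s n)) (scalS c l)) with (scalS c (subS (s n) l)).
  2:{ apply seq_ext; intros; unfold subS, scalS; ring. }
  apply normle_mono with (Cmod c * (e / (Cmod c + 1))). apply normle_scal; auto.
  replace e with ((Cmod c + 1) * (e / (Cmod c+1))) at 2 by (field; lra).
  apply Rmult_le_compat_r; [|lra]. left; apply Rdiv_lt_0_compat; lra.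
Qed.

Lemma conv_const l : conv (fun _ => l) l.
Proof.
  intros e He. exists 0%nat. intros n _. apply normle_mono with 0; [|lra].
  replace (subS l l) with zeroS. apply normle_zero.
  apply seq_ext; intros; unfold subS, zeroS; ring.
Qed.

Lemma conv_of_tail s l (eps : nat -> R) :
  is_lim_seq eps 0 -> (forall n, normle (subS (s n) l) (eps n)) -> conv s l.
Proof.
  intros He Hs e Hpos. apply is_lim_seq_spec in He.
  destruct (He (mkposreal e Hpos)) as [N HN]. exists N. intros n Hn.
  specialize (HN n Hn). simpl in HN. rewrite Rminus_0_r in HN.
  apply normle_mono with (eps n); auto. apply Rabs_def2 in HN. lra.
Qed.

(** A candidate limit for every sequence of vectors, so that sums of series are total functions. It
    is meaningful once [cauchy_conv] applies. *)
Definition coord_lim (s : nat -> seqC) : seqC := fun n =>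
  (real (Lim_seq (fun k => fst (s k n))), real (Lim_seq (fun k => snd (s k n)))).

Lemma Cmod_fst_le z : Rabs (fst z) <= Cmod z.
Proof.
  rewrite <- (Rabs_pos_eq (Cmod z)) by apply Cmod_ge_0.
  apply Rsqr_le_abs_0. unfold Rsqr. assert (H := Cmod_sqr z).
  assert (0 <= snd z ^ 2) by apply pow2_ge_0. simpl in *; lra.
Qed.
Lemma Cmod_snd_le z : Rabs (snd z) <= Cmod z.
Proof.
  rewrite <- (Rabs_pos_eq (Cmod z)) by apply Cmod_ge_0.
  apply Rsqr_le_abs_0. unfold Rsqr. assert (H := Cmod_sqr z).
  assert (0 <= fst z ^ 2) by apply pow2_ge_0. simpl in *; lra.
Qed.

Lemma is_lim_seq_Cmod_sqr (u : nat -> C) (l : C) :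
  is_lim_seq (fun k => fst (u k)) (fst l) -> is_lim_seq (fun k => snd (u k)) (snd l) ->
  is_lim_seq (fun k => Cmod (u k) ^ 2) (Cmod l ^ 2).
Proof.
  intros H1 H2. rewrite Cmod_sqr.
  apply is_lim_seq_ext with (fun k => fst (u k) * fst (u k) + snd (u k) * snd (u k)).
  { intros; rewrite Cmod_sqr; ring. }
  replace (fst l ^ 2 + snd l ^ 2) with (fst l * fst l + snd l * snd l) by ring.
  apply is_lim_seq_plus'; apply is_lim_seq_mult'; auto.
Qed.

Definition cauchy_normle (s : nat -> seqC) : Prop :=
  forall eps, 0 < eps -> exists N, forall n m, (N <= n)%nat -> (N <= m)%nat ->
    normle (subS (s n) (s m)) eps.

Lemma cauchy_coord_lim (s : nat -> seqC) (p : C -> R) n : cauchy_normle s ->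
  (forall z w : C, Rabs (p z - p w) <= Cmod (z - w)%C) ->
  is_lim_seq (fun k => p (s k n)) (real (Lim_seq (fun k => p (s k n)))).
Proof.
  intros Hs Hp. apply Lim_seq_correct'. apply ex_lim_seq_cauchy_corr.
  intros [e He]. destruct (Hs (e / 2)) as [N HN]; [lra|]. exists N. intros k m Hk Hm.
  assert (H := normle_coord _ _ n (HN k m Hk Hm)). simpl.
  eapply Rle_lt_trans; [apply Hp|]. unfold subS in H. lra.
Qed.

(** A partial sum of squares involves finitely many coordinates, so the Cauchy bound [e ^ 2]
    survives the coordinatewise limit of one of the two indices. *)
Lemma cauchy_conv (s : nat -> seqC) : cauchy_normle s -> conv s (coord_lim s).
Proof.
  intros Hs.
  assert (L1 : forall n, is_lim_seq (fun k => fst (s k n)) (fst (coord_lim s n))).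
  { intros n. apply (cauchy_coord_lim s fst n Hs). intros z w. apply (Cmod_fst_le (z - w)%C). }
  assert (L2 : forall n, is_lim_seq (fun k => snd (s k n)) (snd (coord_lim s n))).
  { intros n. apply (cauchy_coord_lim s snd n Hs). intros z w. apply (Cmod_snd_le (z - w)%C). }
  intros e He. destruct (Hs e He) as [N0 HN0]. exists N0. intros M HM.
  split; [lra|]. intros N.
  assert (Hl : is_lim_seq (fun k => sum_n (fun n => Cmod (subS (s k) (s M) n) ^ 2) N)
    (sum_n (fun n => Cmod (subS (s M) (coord_lim s) n) ^ 2) N)).
  { assert (Hn : forall n, is_lim_seq (fun k => Cmod (subS (s k) (s M) n) ^ 2)
      (Cmod (subS (s M) (coord_lim s) n) ^ 2)).
    { intros n. unfold subS.
      replace (s M n - coord_lim s n)%C with (- (coord_lim s n - s M n))%C by ring.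
      rewrite Cmod_opp. apply is_lim_seq_Cmod_sqr; simpl.
      - apply is_lim_seq_minus'; auto. apply is_lim_seq_const.
      - apply is_lim_seq_minus'; auto. apply is_lim_seq_const. }
    induction N.
    - rewrite sum_n_0. eapply is_lim_seq_ext; [|apply Hn]. intros; now rewrite sum_n_0.
    - rewrite sum_n_S. eapply is_lim_seq_ext; [intros k; symmetry; apply sum_n_S|].
      apply is_lim_seq_plus'; auto. }
  apply (is_lim_seq_le_loc _ (fun _ => e ^ 2) _ _) with (2 := Hl) (3 := is_lim_seq_const _).
  exists N0. intros k Hk. apply (HN0 k M Hk HM).
Qed.

Lemma conv_of_summable_tails (s : nat -> seqC) (eps : nat -> R) :
  is_lim_seq eps 0 ->
  (forall M N, (M <= N)%nat -> normle (subS (s N) (s M)) (eps M)) ->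
  conv s (coord_lim s).
Proof.
  intros He Hs. apply cauchy_conv. intros e Hpos. apply is_lim_seq_spec in He.
  assert (He2 : 0 < e / 2) by lra.
  destruct (He (mkposreal _ He2)) as [N HN]. exists N. intros n m Hn Hm.
  specialize (HN N (le_n N)). simpl in HN. rewrite Rminus_0_r in HN.
  apply Rabs_def2 in HN.
  apply normle_mono with (eps N + eps N); [|lra].
  replace (subS (s n) (s m)) with (subS (subS (s n) (s N)) (subS (s m) (s N))).
  now apply normle_sub; apply Hs.
  apply seq_ext; intros; unfold subS; ring.
Qed.

(** * Series of vectors *)

Lemma conv_shift s l : conv s l -> conv (fun n => s (S n)) l.
Proof. intros H e He. destruct (H e He) as [N HN]. exists N. intros; apply HN; lia. Qed.

Fixpoint vpart (u : nat -> seqC) (N : nat) : seqC :=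
  match N with O => zeroS | S n => addS (vpart u n) (u n) end.

Lemma l2_vpart u N : (forall k, l2 (u k)) -> l2 (vpart u N).
Proof. intros H; induction N; simpl. apply l2_zero. now apply l2_add. Qed.

Lemma vpart_linear T u N : linear_l2 T -> (forall k, l2 (u k)) ->
  T (vpart u N) = vpart (fun k => T (u k)) N.
Proof.
  intros HT Hu; induction N; simpl. now apply linear_zero.
  rewrite (proj1 HT), IHN; auto. now apply l2_vpart.
Qed.

Lemma vpart_S u N : vpart u (S N) = addS (u O) (vpart (fun k => u (S k)) N).
Proof.
  induction N.
  - simpl. apply seq_ext; intros; unfold addS, zeroS; ring.
  - change (vpart u (S (S N))) with (addS (vpart u (S N)) (u (S N))). rewrite IHN. simpl.
    apply seq_ext; intros; unfold addS; ring.
Qed.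

Lemma vpart_ext u v N : (forall k, u k = v k) -> vpart u N = vpart v N.
Proof. intros H; induction N; simpl; congruence. Qed.

Lemma vpart_add u v N :
  vpart (fun k => addS (u k) (v k)) N = addS (vpart u N) (vpart v N).
Proof.
  induction N; simpl. apply seq_ext; intros; unfold addS, zeroS; ring.
  rewrite IHN. apply seq_ext; intros; unfold addS; ring.
Qed.

Lemma vpart_scal c u N :
  vpart (fun k => scalS c (u k)) N = scalS c (vpart u N).
Proof.
  induction N; simpl. apply seq_ext; intros; unfold scalS, zeroS; ring.
  rewrite IHN. apply seq_ext; intros; unfold addS, scalS; ring.
Qed.

Definition vsum (u : nat -> seqC) : seqC := coord_lim (vpart u).

Section Geometric.
Variables (u : nat -> seqC) (B q : R).
Hypothesis Hq : 0 <= q < 1.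
Hypothesis Hu : forall k, normle (u k) (B * q ^ k).

Lemma geom_B_pos : 0 <= B.
Proof. generalize (proj1 (Hu 0)). simpl. lra. Qed.

(** The bound is the exact finite geometric sum, which lets the induction step close with an
    equality of bounds. *)
Lemma vpart_geom_tail M d :
  normle (subS (vpart u (M + d)) (vpart u M)) (B * q ^ M * (1 - q ^ d) / (1 - q)).
Proof.
  induction d.
  - rewrite Nat.add_0_r. replace (subS _ _) with zeroS.
    replace (_ / _) with 0. apply normle_zero. simpl; field; lra.
    apply seq_ext; intros; unfold subS, zeroS; ring.
  - rewrite Nat.add_succ_r. simpl vpart.
    replace (subS _ _) with (addS (subS (vpart u (M + d)) (vpart u M)) (u (M + d)%nat)).
    2:{ apply seq_ext; intros; unfold subS, addS; ring. }
    replace (B * q ^ M * (1 - q ^ (S d)) / (1 - q)) with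
      (B * q ^ M * (1 - q ^ d) / (1 - q) + B * q ^ (M + d)).
    apply normle_add; auto.
    rewrite pow_add. simpl. field; lra.
Qed.

Lemma vsum_geom : conv (vpart u) (vsum u) /\ normle (vsum u) (B / (1 - q)).
Proof.
  assert (HB := geom_B_pos).
  assert (C : conv (vpart u) (vsum u)).
  { apply conv_of_summable_tails with (fun M => B / (1 - q) * q ^ M).
    - replace (Finite 0) with (Rbar_mult (B / (1 - q)) 0).
      apply is_lim_seq_scal_l. apply is_lim_seq_geom. rewrite Rabs_pos_eq; lra.
      simpl. f_equal; ring.
    - intros M N HMN. replace N with (M + (N - M))%nat by lia.
      eapply normle_mono. apply vpart_geom_tail.
      assert (0 <= q ^ (N - M)) by (apply pow_le; lra).
      assert (0 <= q ^ M) by (apply pow_le; lra).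
      assert (0 <= B / (1 - q)) by (apply Rmult_le_pos; [lra|left; apply Rinv_0_lt_compat; lra]).
      replace (B * q ^ M * (1 - q ^ (N - M)) / (1 - q)) with
        (B / (1 - q) * q ^ M * (1 - q ^ (N - M))) by (field; lra).
      assert (0 <= B / (1 - q) * q ^ M) by (apply Rmult_le_pos; auto). nra. }
  split; auto.
  apply conv_normle with (vpart u); auto. intros N.
  assert (H := vpart_geom_tail 0 N). simpl in H.
  replace (subS (vpart u N) zeroS) with (vpart u N) in H.
  2:{ apply seq_ext; intros; unfold subS, zeroS; ring. }
  eapply normle_mono. apply H.
  assert (0 <= q ^ N) by (apply pow_le; lra).
  unfold Rdiv. apply Rmult_le_compat_r. left; apply Rinv_0_lt_compat; lra. nra.
Qed.
End Geometric.

(** Serves twice: for the Neumann series and for the operator [X] of [hardy_model]. *)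
Lemma vsum_linear (F : nat -> op) (K q : R) : 0 <= q < 1 ->
  (forall k, bounded_l2 (F k) (K * q ^ k)) -> bounded_l2 (fun f => vsum (fun k => F k f)) (K / (1 - q)).
Proof.
  intros Hq HF.
  assert (HK : 0 <= K). { generalize (proj1 (proj2 (HF O))). simpl; lra. }
  assert (H : forall f B, normle f B -> conv (vpart (fun k => F k f)) (vsum (fun k => F k f)) /\
    normle (vsum (fun k => F k f)) (B * K / (1 - q))).
  { intros f B Hf. apply vsum_geom; auto. intros k.
    replace (B * K * q ^ k) with (K * q ^ k * B) by ring. now apply HF. }
  split; [split|split].
  - intros f g [A Hf] [B Hg].
    apply conv_unique with (vpart (fun k => F k (addS f g))).
    apply H with (A + B). now apply normle_add.
    eapply conv_ext; [|apply conv_add; [eapply H, Hf|eapply H, Hg]].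
    intros n; simpl. rewrite <- vpart_add. apply vpart_ext; intros k.
    symmetry; apply HF; eexists; eauto.
  - intros c f [A Hf].
    apply conv_unique with (vpart (fun k => F k (scalS c f))).
    eapply H. now apply normle_scal, Hf.
    eapply conv_ext; [|apply conv_scal; eapply H, Hf].
    intros n; simpl. rewrite <- vpart_scal. apply vpart_ext; intros k.
    symmetry; apply HF; eexists; eauto.
  - apply Rmult_le_pos; auto. left; apply Rinv_0_lt_compat; lra.
  - intros f B Hf. replace (K / (1 - q) * B) with (B * K / (1 - q)) by (unfold Rdiv; ring).
    now apply H.
Qed.

Lemma bounded_iter T K k : bounded_l2 T K -> bounded_l2 (fun f => Nat.iter k T f) (K ^ k).
Proof.
  intros H; induction k; simpl. apply bounded_id.
  apply (bounded_comp T (fun f => Nat.iter k T f)); auto.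
Qed.

Definition neumann (T : op) : op := fun f => vsum (fun k => Nat.iter k T f).

Lemma bounded_ext T K K' : bounded_l2 T K -> K = K' -> bounded_l2 T K'.
Proof. now intros H <-. Qed.

Lemma neumann_bounded T q : bounded_l2 T q -> q < 1 -> bounded_l2 (neumann T) (/ (1 - q)).
Proof.
  intros HT Hq. assert (0 <= q) by apply HT.
  apply bounded_ext with (1 / (1 - q)); [|unfold Rdiv; ring].
  apply (vsum_linear (fun k f => Nat.iter k T f)); [lra|].
  intros k. apply bounded_ext with (q ^ k); [|ring]. now apply bounded_iter.
Qed.

Lemma neumann_conv T q f : bounded_l2 T q -> q < 1 -> l2 f ->
  conv (vpart (fun k => Nat.iter k T f)) (neumann T f).
Proof.
  intros HT Hq [B Hf]. assert (0 <= q) by apply HT.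
  apply (vsum_geom _ B q); [lra|]. intros k. rewrite Rmult_comm.
  now apply (bounded_iter T q k HT).
Qed.

(** [T] shifts the partial sums by one index and drops the first term [f], so both sides are limits
    of the same sequence. This makes [neumann T] a right inverse of [I - T]. *)
Lemma neumann_eq T q f : bounded_l2 T q -> q < 1 -> l2 f ->
  T (neumann T f) = subS (neumann T f) f.
Proof.
  intros HT Hq Hf.
  assert (Hu : forall k, l2 (Nat.iter k T f)).
  { intros k. apply (bounded_maps_l2 _ _ _ (bounded_iter T q k HT) Hf). }
  assert (C := neumann_conv T q f HT Hq Hf).
  apply conv_unique with (fun N => T (vpart (fun k => Nat.iter k T f) N)).
  - apply conv_bounded with q; auto. intros; now apply l2_vpart.
  - rewrite subS_add.
    eapply conv_ext; [|apply conv_add; [apply conv_shift, C|apply (conv_const (scalS (-1) f))]].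
    intros N; simpl. rewrite vpart_linear; auto; [|apply HT].
    change (addS (vpart (fun k : nat => Nat.iter k T f) N) (Nat.iter N T f)) with
      (vpart (fun k : nat => Nat.iter k T f) (S N)). rewrite vpart_S. simpl.
    apply seq_ext; intros; unfold addS, scalS; ring.
Qed.

(** * Tails and synthesis from Bessel sequences *)

Definition tail_from (M : nat) (f : seqC) : seqC := fun n => if Nat.ltb n M then RtoC 0 else f n.

Lemma l2_ex_series f : l2 f -> ex_series (fun n => Cmod (f n) ^ 2).
Proof.
  intros [B [HB H]].
  assert (H1 : ex_finite_lim_seq (sum_n (fun n => Cmod (f n) ^ 2))).
  { apply ex_finite_lim_seq_incr with (B ^ 2); auto.
    intros n. rewrite sum_n_S. assert (0 <= Cmod (f (S n)) ^ 2) by apply pow2_ge_0. lra. }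
  destruct H1 as [l Hl]. exists l. exact Hl.
Qed.

Lemma sum_le_Series (u : nat -> R) N : (forall n, 0 <= u n) -> ex_series u ->
  sum_n u N <= Series u.
Proof.
  intros Hp He. apply Series_correct in He.
  apply (is_lim_seq_incr_compare (sum_n u)); auto.
  intros n. rewrite sum_n_S. specialize (Hp (S n)); lra.
Qed.

Lemma normle_Series f : l2 f -> normle f (sqrt (Series (fun n => Cmod (f n) ^ 2))).
Proof.
  intros H. split. apply sqrt_pos. intros N. 
  assert (Hs := sum_le_Series (fun n => Cmod (f n) ^ 2)).
  assert (H0 : 0 <= Series (fun n => Cmod (f n) ^ 2)).
  { apply Rle_trans with (2 := Hs 0%nat (fun n => pow2_ge_0 _) (l2_ex_series f H)).
    rewrite sum_n_0. apply pow2_ge_0. }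
  rewrite pow2_sqrt; auto. apply Hs. intros; apply pow2_ge_0. now apply l2_ex_series.
Qed.

Lemma tail_small f : l2 f -> exists eps : nat -> R,
  is_lim_seq eps 0 /\ forall M, normle (tail_from M f) (eps M).
Proof.
  intros Hf. set (v := fun n => Cmod (f n) ^ 2). set (t := Series v).
  assert (Hv : forall n, 0 <= v n) by (intros; apply pow2_ge_0).
  assert (Hex := l2_ex_series f Hf). fold v in Hex.
  assert (Hle : forall N, sum_n v N <= t) by (intros; now apply sum_le_Series).
  (* [tail_from M] deletes the indices below [M], whereas [sum_n v m] includes the index [m]; hence
     the shift by one and the separate case at 0. *)
  exists (fun M => match M with O => sqrt t | S m => sqrt (t - sum_n v m) end).
  split.
  - apply is_lim_seq_incr_1. rewrite <- sqrt_0.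
    apply is_lim_seq_continuous. apply continuity_pt_sqrt; lra.
    replace 0 with (t - t) by ring. apply is_lim_seq_minus'. apply is_lim_seq_const.
    apply (Series_correct v Hex).
  - intros [|m].
    + replace (tail_from 0 f) with f. now apply normle_Series.
      apply seq_ext; intros n; reflexivity.
    + split. apply sqrt_pos. intros N. rewrite pow2_sqrt by (specialize (Hle m); lra).
      assert (E : forall N, ((N <= m)%nat -> sum_n (fun n => Cmod (tail_from (S m) f n) ^ 2) N = 0) /\
         sum_n (fun n => Cmod (tail_from (S m) f n) ^ 2) (m + N) = sum_n v (m + N) - sum_n v m).
      { assert (E1 : forall N, (N <= m)%nat -> sum_n (fun n => Cmod (tail_from (S m) f n) ^ 2) N = 0).
        { intros N0; induction N0 as [|N0 IH]; intros HN; rewrite ?sum_n_0, ?sum_n_S, ?IH by lia; unfold tail_from.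
          - change (Nat.ltb 0 (S m)) with true. cbv iota. rewrite Cmod_0; simpl; ring.
          - destruct (Nat.ltb_spec (S N0) (S m)); [|lia]. rewrite Cmod_0; simpl; ring. }
        intros N0. split; auto.
        induction N0. rewrite Nat.add_0_r, E1 by lia. lra.
        rewrite Nat.add_succ_r, !sum_n_S, IHN0. unfold tail_from at 1.
        destruct (Nat.ltb_spec (S (m + N0)) (S m)); [lia|]. unfold v; lra. }
      destruct (Nat.le_gt_cases N m).
      * rewrite (proj1 (E N)) by auto. specialize (Hle m); lra.
      * replace N with (m + (N - m))%nat by lia. rewrite (proj2 (E _)).
        specialize (Hle (m + (N - m))%nat); lra.
Qed.

Definition fpart (q : nat -> seqC) (f : seqC) (N : nat) : seqC :=
  vpart (fun k => scalS (f k) (q k)) N.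

Definition synthesis (q : nat -> seqC) (f : seqC) : seqC := coord_lim (fpart q f).

(** Bessel bound with constant 1, on finite sums. Its two instances are the Takenaka-Malmquist
    system, which yields [W], and an orthonormal sequence in the kernel, which yields the embedding
    [S]. *)
Definition bessel (q : nat -> seqC) : Prop :=
  forall f B N, normle f B -> normle (fpart q f N) B.

(** Rewrites a difference of partial sums as the synthesis of a tail, so that the Bessel bound gives
    the Cauchy estimate directly. *)
Lemma fpart_tail q f M N : (M <= N)%nat ->
  subS (fpart q f N) (fpart q f M) = fpart q (tail_from M f) N.
Proof.
  intros H. replace N with (M + (N - M))%nat by lia. generalize (N - M)%nat as d. clear.
  assert (E : forall N, (N <= M)%nat -> fpart q (tail_from M f) N = zeroS).
  { induction N; intros H; simpl; auto. unfold fpart in *; simpl. rewrite IHN by lia.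
    unfold tail_from. destruct (Nat.ltb_spec N M); [|lia].
    apply seq_ext; intros; unfold addS, scalS, zeroS; ring. }
  induction d.
  - rewrite Nat.add_0_r, E by auto. apply seq_ext; intros; unfold subS, zeroS; ring.
  - rewrite Nat.add_succ_r. unfold fpart in *; simpl. rewrite <- IHd.
    unfold tail_from. destruct (Nat.ltb_spec (M + d) M); [lia|].
    apply seq_ext; intros; unfold addS, subS; ring.
Qed.

Lemma synthesis_conv q f : bessel q -> l2 f -> conv (fpart q f) (synthesis q f).
Proof.
  intros Hq Hf. destruct (tail_small f Hf) as (eps & He & Ht).
  apply conv_of_summable_tails with eps; auto. intros M N HMN. rewrite fpart_tail; auto.
Qed.

Lemma fpart_add q f g N : fpart q (addS f g) N = addS (fpart q f N) (fpart q g N).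
Proof.
  unfold fpart. rewrite <- vpart_add. apply vpart_ext; intros k.
  apply seq_ext; intros; unfold addS, scalS; ring.
Qed.
Lemma fpart_scal q c f N : fpart q (scalS c f) N = scalS c (fpart q f N).
Proof.
  unfold fpart. rewrite <- vpart_scal. apply vpart_ext; intros k.
  apply seq_ext; intros; unfold scalS; ring.
Qed.

Lemma synthesis_bounded q : bessel q -> bounded_l2 (synthesis q) 1.
Proof.
  intros Hq. assert (C := fun f => synthesis_conv q f Hq). split; [split|split].
  - intros f g Hf Hg. apply conv_unique with (fpart q (addS f g)).
    apply C; now apply l2_add.
    eapply conv_ext; [|apply conv_add; apply C; auto]. intros; simpl; now rewrite fpart_add.
  - intros c f Hf. apply conv_unique with (fpart q (scalS c f)).
    apply C; now apply l2_scal.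
    eapply conv_ext; [|apply conv_scal; apply C; auto]. intros; simpl; now rewrite fpart_scal.
  - lra.
  - intros f B Hf. rewrite Rmult_1_l. apply conv_normle with (fpart q f). apply C. now exists B.
    auto.
Qed.

(** * Evaluation on the real segment *)

(** Weaker than [l2], so that evaluation also applies to the quotients [div_lin a h], whose
    coefficients are only shown to be bounded. *)
Definition coef_bounded (f : seqC) : Prop := exists B, forall n, Cmod (f n) <= B.

Lemma l2_coef_bounded f : l2 f -> coef_bounded f.
Proof. intros [B H]; exists B; intros; now apply normle_coord. Qed.

Lemma coef_bounded_add f g : coef_bounded f -> coef_bounded g -> coef_bounded (addS f g).
Proof.
  intros [A HA] [B HB]. exists (A + B). intros n. unfold addS.
  eapply Rle_trans. apply Cmod_triangle. specialize (HA n); specialize (HB n); lra.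
Qed.

Lemma coef_bounded_scal c f : coef_bounded f -> coef_bounded (scalS c f).
Proof.
  intros [A HA]. exists (Cmod c * A). intros n. unfold scalS. rewrite Cmod_mult.
  apply Rmult_le_compat_l; auto. apply Cmod_ge_0.
Qed.

Definition mul_z (f : seqC) : seqC := fun n => match n with O => RtoC 0 | S m => f m end.

Lemma coef_bounded_mul_z f : coef_bounded f -> coef_bounded (mul_z f).
Proof.
  intros [A HA]. exists A. intros [|n]; simpl; auto. rewrite Cmod_0.
  apply Rle_trans with (2 := HA O). apply Cmod_ge_0.
Qed.

Definition eval (x : R) (f : seqC) : C :=
  (PSeries (fun n => fst (f n)) x, PSeries (fun n => snd (f n)) x).

Lemma ex_pseries_coef_bounded (u : nat -> R) B x : (forall n, Rabs (u n) <= B) -> Rabs x < 1 ->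
  ex_series (fun n => u n * x ^ n) /\ Rabs (PSeries u x) <= B / (1 - Rabs x).
Proof.
  intros Hu Hx.
  assert (Hg : is_series (fun n => B * Rabs x ^ n) (B / (1 - Rabs x))).
  { unfold Rdiv. apply (is_series_scal_l B (fun n => Rabs x ^ n)).
    apply is_series_geom. now rewrite Rabs_Rabsolu. }
  assert (Hle : forall n, Rabs (u n * x ^ n) <= B * Rabs x ^ n).
  { intros n. rewrite Rabs_mult, RPow_abs. apply Rmult_le_compat_r; auto. apply Rabs_pos. }
  assert (Ha : ex_series (fun n => Rabs (u n * x ^ n))).
  { apply (ex_series_le (fun n => Rabs (u n * x ^ n)) (fun n => B * Rabs x ^ n)).
    intros n. unfold norm; simpl. unfold abs; simpl. rewrite Rabs_Rabsolu. auto.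
    eexists; apply Hg. }
  split. now apply ex_series_Rabs.
  unfold PSeries. eapply Rle_trans. apply Series_Rabs; auto.
  rewrite <- (is_series_unique _ _ Hg). apply Series_le.
  intros n; split; auto. apply Rabs_pos. eexists; apply Hg.
Qed.

Lemma eval_bound x f B : Rabs x < 1 -> (forall n, Cmod (f n) <= B) ->
  Cmod (eval x f) <= 2 * (B / (1 - Rabs x)).
Proof.
  intros Hx Hf.
  destruct (ex_pseries_coef_bounded (fun n => fst (f n)) B x) as [_ H1]; auto.
  { intros n. eapply Rle_trans. apply Cmod_fst_le. auto. }
  destruct (ex_pseries_coef_bounded (fun n => snd (f n)) B x) as [_ H2]; auto.
  { intros n. eapply Rle_trans. apply Cmod_snd_le. auto. }
  assert (H := Cmod_sqr (eval x f)). unfold eval in H at 2 3; simpl fst in H; simpl snd in H.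
  assert (P := Cmod_ge_0 (eval x f)).
  set (p := PSeries _ x) in *. set (q := PSeries (fun n => snd (f n)) x) in *.
  set (b := B / (1 - Rabs x)) in *.
  assert (0 <= b) by (eapply Rle_trans; [apply Rabs_pos|apply H1]).
  apply Rsqr_incr_0_var; [|lra]. unfold Rsqr.
  assert (p ^ 2 <= b ^ 2). { rewrite <- (pow2_abs p). apply pow_incr; split; auto. apply Rabs_pos. }
  assert (q ^ 2 <= b ^ 2). { rewrite <- (pow2_abs q). apply pow_incr; split; auto. apply Rabs_pos. }
  simpl in *. nra.
Qed.

Lemma coef_bounded_ex_pseries x f : coef_bounded f -> Rabs x < 1 ->
  ex_pseries (fun n => fst (f n)) x /\ ex_pseries (fun n => snd (f n)) x.
Proof.
  intros [B Hf] Hx. split; apply ex_pseries_R; apply ex_pseries_coef_bounded with B; auto; intros n;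
  eapply Rle_trans; try apply Hf; [apply Cmod_fst_le|apply Cmod_snd_le].
Qed.

Lemma eval_add x f g : Rabs x < 1 -> coef_bounded f -> coef_bounded g -> eval x (addS f g) = (eval x f + eval x g)%C.
Proof.
  intros Hx Hf Hg. destruct (coef_bounded_ex_pseries x f Hf Hx), (coef_bounded_ex_pseries x g Hg Hx).
  unfold eval, Cplus; simpl. f_equal; rewrite <- PSeries_plus; auto.
Qed.

Lemma eval_scal x c f : Rabs x < 1 -> coef_bounded f -> eval x (scalS c f) = (c * eval x f)%C.
Proof.
  intros Hx Hf. destruct (coef_bounded_ex_pseries x f Hf Hx) as [H1 H2].
  apply (ex_pseries_R) in H1. apply ex_pseries_R in H2.
  unfold eval, Cmult; simpl. unfold PSeries. f_equal.
  - rewrite <- !Series_scal_l.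
    rewrite <- Series_minus;
      [|exact (ex_series_scal_l _ _ H1)|exact (ex_series_scal_l _ _ H2)].
    apply Series_ext; intros n; unfold scalS, Cmult; simpl; ring.
  - rewrite <- !Series_scal_l.
    rewrite <- Series_plus;
      [|exact (ex_series_scal_l _ _ H2)|exact (ex_series_scal_l _ _ H1)].
    apply Series_ext; intros n; unfold scalS, Cmult; simpl; ring.
Qed.

Lemma eval_mul_z x f : eval x (mul_z f) = (RtoC x * eval x f)%C.
Proof.
  unfold eval, Cmult; simpl.
  rewrite (PSeries_ext (fun n => fst (mul_z f n)) (PS_incr_1 (fun n => fst (f n)))).
  rewrite (PSeries_ext (fun n => snd (mul_z f n)) (PS_incr_1 (fun n => snd (f n)))).
  rewrite !PSeries_incr_1. f_equal; ring.
  all: intros [|n]; reflexivity.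
Qed.

Lemma eval_0 f : eval 0 f = f O.
Proof. unfold eval. rewrite !PSeries_0. now destruct (f O). Qed.

Lemma eval_inj f g : coef_bounded f -> coef_bounded g -> (forall x, Rabs x < 1 -> eval x f = eval x g) -> f = g.
Proof.
  intros [A Hf] [B Hg] H.
  assert (HR : forall (u : nat -> R) b, (forall n, Rabs (u n) <= b) -> Rbar_lt 0 (CV_radius u)).
  { intros u b Hu. apply Rbar_lt_le_trans with (Finite 1). simpl; lra.
    apply CV_radius_bounded. exists b. intros n. now rewrite pow1, Rmult_1_r. }
  assert (HL : forall P : R -> Prop, (forall x, Rabs x < 1 -> P x) -> locally 0 P).
  { intros P HP. exists (mkposreal 1 Rlt_0_1). intros y Hy. apply HP.
    unfold ball in Hy; simpl in Hy. unfold AbsRing_ball, abs, minus, plus, opp in Hy; simpl in Hy.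
    now rewrite Ropp_0, Rplus_0_r in Hy. }
  apply seq_ext; intros n. rewrite (surjective_pairing (f n)), (surjective_pairing (g n)).
  f_equal.
  - apply (PSeries_ext_recip (fun n => fst (f n)) (fun n => fst (g n))).
    + apply HR with A. intros; eapply Rle_trans; [apply Cmod_fst_le|auto].
    + apply HR with B. intros; eapply Rle_trans; [apply Cmod_fst_le|auto].
    + apply HL. intros x Hx. apply (f_equal fst (H x Hx)).
  - apply (PSeries_ext_recip (fun n => snd (f n)) (fun n => snd (g n))).
    + apply HR with A. intros; eapply Rle_trans; [apply Cmod_snd_le|auto].
    + apply HR with B. intros; eapply Rle_trans; [apply Cmod_snd_le|auto].
    + apply HL. intros x Hx. apply (f_equal snd (H x Hx)).
Qed.

Definition Clim (u : nat -> C) (l : C) : Prop :=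
  forall eps, 0 < eps -> exists N, forall n, (N <= n)%nat -> Cmod (u n - l) <= eps.

Lemma Clim_unique u l l' : Clim u l -> Clim u l' -> l = l'.
Proof.
  intros H H'. assert (E : Cmod (l - l') = 0).
  { apply Rle_antisym; [|apply Cmod_ge_0]. apply le_epsilon. intros e He.
    destruct (H (e/2)) as [N HN]; [lra|]. destruct (H' (e/2)) as [N' HN']; [lra|].
    specialize (HN (max N N') ltac:(lia)). specialize (HN' (max N N') ltac:(lia)).
    replace (l - l')%C with ((u (max N N') - l') + - (u (max N N') - l))%C by ring.
    eapply Rle_trans. apply Cmod_triangle. rewrite Cmod_opp. lra. }
  apply Cmod_eq_0 in E. replace l with (l - l' + l')%C by ring. rewrite E; ring.
Qed.

Lemma Clim_scal c u l : Clim u l -> Clim (fun n => c * u n)%C (c * l)%C.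
Proof.
  intros H e He. assert (Hc := Cmod_ge_0 c).
  destruct (H (e / (Cmod c + 1))) as [N HN]. apply Rdiv_lt_0_compat; lra.
  exists N. intros n Hn. replace (c * u n - c * l)%C with (c * (u n - l))%C by ring.
  rewrite Cmod_mult. specialize (HN n Hn).
  replace e with ((Cmod c + 1) * (e / (Cmod c+1))) by (field; lra).
  assert (0 < e / (Cmod c + 1)) by (apply Rdiv_lt_0_compat; lra).
  apply Rmult_le_compat; auto; try apply Cmod_ge_0; lra.
Qed.

Lemma Clim_ext u v l : (forall n, u n = v n) -> Clim u l -> Clim v l.
Proof. intros E H e He. destruct (H e He) as [N HN]. exists N. intros; rewrite <- E; auto. Qed.

Lemma conv_coord s l n : conv s l -> Clim (fun k => s k n) (l n).
Proof.
  intros H e He. destruct (H e He) as [N HN]. exists N. intros k Hk.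
  apply (normle_coord _ _ n (HN k Hk)).
Qed.

Lemma conv_eval s l x : Rabs x < 1 -> (forall n, l2 (s n)) -> conv s l ->
  Clim (fun k => eval x (s k)) (eval x l).
Proof.
  intros Hx Hs H e He. assert (Hl := conv_l2 s l Hs H).
  assert (P : 0 < (1 - Rabs x)) by lra.
  destruct (H (e * (1 - Rabs x) / 2)) as [N HN]. { apply Rdiv_lt_0_compat; nra. }
  exists N. intros n Hn.
  replace (eval x (s n) - eval x l)%C with (eval x (subS (s n) l)).
  eapply Rle_trans. apply eval_bound; auto. intros k; apply normle_coord, HN, Hn.
  right; field; lra.
  rewrite subS_add, eval_add, eval_scal; auto using l2_coef_bounded. ring.
  apply coef_bounded_scal; now apply l2_coef_bounded.
Qed.

Definition delta (k : nat) : seqC := fun n => if Nat.eqb n k then RtoC 1 else RtoC 0.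

Lemma delta_S k : delta (S k) = mul_z (delta k).
Proof. apply seq_ext; intros [|n]; reflexivity. Qed.

Lemma normle_delta k : normle (delta k) 1.
Proof.
  split; [lra|]. intros N.
  assert (E : forall N, ((N < k)%nat -> sum_n (fun n => Cmod (delta k n) ^ 2) N = 0) /\
    sum_n (fun n => Cmod (delta k n) ^ 2) (k + N) = 1).
  { assert (E1 : forall N, (N < k)%nat -> sum_n (fun n => Cmod (delta k n) ^ 2) N = 0).
    { intros N0; induction N0 as [|N0 IH]; intros HN; rewrite ?sum_n_0, ?sum_n_S, ?IH by lia; unfold delta.
      - destruct (Nat.eqb_spec 0 k); [lia|]. rewrite Cmod_0; simpl; lra.
      - destruct (Nat.eqb_spec (S N0) k); [lia|]. rewrite Cmod_0; simpl; lra. }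
    intros N0; split; auto. induction N0.
    - rewrite Nat.add_0_r. destruct k. rewrite sum_n_0. unfold delta; simpl. rewrite Cmod_1; simpl; lra.
      rewrite sum_n_S, E1 by lia. unfold delta. rewrite Nat.eqb_refl, Cmod_1; simpl; lra.
    - rewrite Nat.add_succ_r, sum_n_S, IHN0. unfold delta.
      destruct (Nat.eqb_spec (S (k + N0)) k); [lia|]. rewrite Cmod_0; simpl; lra. }
  destruct (Nat.lt_ge_cases N k).
  - rewrite (proj1 (E N)); auto; lra.
  - replace N with (k + (N - k))%nat by lia. rewrite (proj2 (E _)); lra.
Qed.

Lemma eval_delta x k : Rabs x < 1 -> eval x (delta k) = RtoC (x ^ k).
Proof.
  intros Hx; induction k.
  - destruct (coef_bounded_ex_pseries x (delta 0)) as [H1 H2]; auto.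
    { apply l2_coef_bounded. exists 1. apply normle_delta. }
    unfold eval. rewrite (PSeries_decr_1 _ _ H1), (PSeries_decr_1 _ _ H2).
    assert (Z : forall u : nat -> R, (forall n, u (S n) = 0) -> PSeries (PS_decr_1 u) x = 0).
    { intros u Hu. rewrite (PSeries_ext _ (fun _ => 0)). apply PSeries_const_0. exact Hu. }
    rewrite !Z by reflexivity.
    unfold delta, RtoC; simpl. f_equal; ring.
  - rewrite delta_S, eval_mul_z, IHk. simpl. now rewrite RtoC_mult.
Qed.

Lemma eval_zero x : eval x zeroS = RtoC 0.
Proof. unfold eval, zeroS; simpl. now rewrite !PSeries_const_0. Qed.

Lemma eval_vpart x u N : Rabs x < 1 -> (forall k, l2 (u k)) ->
  eval x (vpart u (S N)) = (eval x (vpart u N) + eval x (u N))%C.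
Proof.
  intros Hx Hu. simpl. apply eval_add; auto; apply l2_coef_bounded; auto. now apply l2_vpart.
Qed.

Lemma fpart_delta_conv f : l2 f -> conv (fpart delta f) f.
Proof.
  intros Hf. destruct (tail_small f Hf) as (eps & He & Ht).
  apply conv_of_tail with eps; auto. intros N.
  replace (subS (fpart delta f N) f) with (scalS (-1) (tail_from N f)).
  { replace (eps N) with (Cmod (-1) * eps N). now apply normle_scal.
    rewrite Cmod_R, Rabs_left; lra. }
  apply seq_ext; intros n.
  assert (E : fpart delta f N n = if Nat.ltb n N then f n else RtoC 0).
  { clear. induction N. reflexivity.
    unfold fpart in *; simpl. unfold addS at 1. rewrite IHN. unfold scalS, delta.
    destruct (Nat.ltb_spec n N), (Nat.ltb_spec n (S N)), (Nat.eqb_spec n N); try lia; subst; ring. }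
  unfold subS, scalS, tail_from. rewrite E. destruct (Nat.ltb n N); ring.
Qed.

(** * Multiplication by linear factors and by Moebius maps *)

Definition mul_lin (c : R) (f : seqC) : seqC := addS f (scalS (RtoC c) (mul_z f)).

Lemma coef_bounded_mul_lin c f : coef_bounded f -> coef_bounded (mul_lin c f).
Proof. intros; apply coef_bounded_add, coef_bounded_scal, coef_bounded_mul_z; auto. Qed.

Lemma eval_mul_lin x c f : Rabs x < 1 -> coef_bounded f -> eval x (mul_lin c f) = (RtoC (1 + c * x) * eval x f)%C.
Proof.
  intros Hx Hf. unfold mul_lin. rewrite eval_add, eval_scal, eval_mul_z; auto using coef_bounded_scal, coef_bounded_mul_z.
  rewrite RtoC_plus, RtoC_mult. ring.
Qed.

Lemma mul_z_bounded : bounded_l2 mul_z 1.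
Proof.
  split; [split|split]; try lra.
  - intros f g _ _. apply seq_ext; intros [|n]; unfold addS, mul_z; simpl; ring.
  - intros c f _. apply seq_ext; intros [|n]; unfold scalS, mul_z; simpl; ring.
  - intros f B [HB H]. rewrite Rmult_1_l. split; auto. intros [|N].
    + rewrite sum_n_0; simpl. rewrite Cmod_0. specialize (H O). rewrite sum_n_0 in H.
      assert (P := pow2_ge_0 (Cmod (f O))). simpl in *; lra.
    + replace (sum_n (fun n => Cmod (mul_z f n) ^ 2) (S N)) with (sum_n (fun n => Cmod (f n) ^ 2) N); auto.
      clear. induction N; rewrite ?sum_n_S, ?sum_n_0. simpl; rewrite Cmod_0; simpl; lra.
      rewrite IHN, sum_n_S. simpl; lra.
Qed.

Lemma mul_lin_bounded c : bounded_l2 (mul_lin c) (1 + Rabs c).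
Proof.
  apply bounded_add. apply bounded_id. apply bounded_ext with (Cmod c * 1).
  apply bounded_scal, mul_z_bounded. rewrite Cmod_R; ring.
Qed.

(** The formal power series [f / (1 + a z)], by forward substitution. *)
Fixpoint div_lin (a : R) (f : seqC) (n : nat) : C :=
  match n with O => f O | S m => (f (S m) - RtoC a * div_lin a f m)%C end.

Lemma mul_lin_div_lin a f : mul_lin a (div_lin a f) = f.
Proof.
  apply seq_ext; intros [|n]; unfold mul_lin, addS, scalS, mul_z; simpl; ring.
Qed.

(* Multiplication by [phi_a]: division by [1 + a z] followed by multiplication by [z + a]. *)
Definition mul_mobius (a : R) (f : seqC) : seqC :=
  addS (mul_z (div_lin a f)) (scalS (RtoC a) (div_lin a f)).

Definition unit_norm (a : R) : R := sqrt (1 - a ^ 2).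

(* The normalised Szego kernel [sqrt (1 - a^2) / (1 + a z)] of [H^2]. *)
Definition tm0 (a : R) : seqC := fun n => RtoC (unit_norm a * (- a) ^ n).

Lemma unit_norm_sqr a : Rabs a < 1 -> unit_norm a * unit_norm a = 1 - a * a.
Proof.
  intros H. unfold unit_norm. apply Rabs_def2 in H. rewrite sqrt_sqrt; [ring|nra].
Qed.

Lemma unit_norm_pos a : Rabs a < 1 -> 0 < unit_norm a.
Proof. intros H. apply sqrt_lt_R0. apply Rabs_def2 in H. nra. Qed.

(* With [k = h / (1 + a z)] one has [h_n = k_n + a k_(n-1)] and [(phi_a h)_n = a k_n + k_(n-1)], so
   all sums telescope; the boundary term on the left is what makes the identity exact. *)
Lemma horner_identity a (alpha : C) h N : Rabs a < 1 ->
  sum_n (fun n => Cmod (addS (scalS alpha (tm0 a)) (mul_mobius a h) n) ^ 2) N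
  + Cmod (RtoC ((- a) ^ (S N)) * alpha + RtoC (unit_norm a) * div_lin a h N)%C ^ 2
  = Cmod alpha ^ 2 + sum_n (fun n => Cmod (h n) ^ 2) N.
Proof.
  intros Ha. assert (Hs := unit_norm_sqr a Ha). set (s := unit_norm a) in *.
  induction N.
  - rewrite !sum_n_0. unfold addS, scalS, tm0, mul_mobius, addS, mul_z, scalS; simpl div_lin; fold s.
    rewrite !Cmod_sqr. destruct alpha as [p q], (h O) as [u v]; simpl. ring [Hs].
  - rewrite !sum_n_S.
    assert (E : forall X Y Z W A B : R, X + A = Y + Z -> W + B = A + Y - Y ->
       X + W + B = Y + Z). { intros; lra. }
    assert (G : Cmod (addS (scalS alpha (tm0 a)) (mul_mobius a h) (S N)) ^ 2 +
      Cmod (RtoC ((- a) ^ (S (S N))) * alpha + RtoC s * div_lin a h (S N))%C ^ 2 =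
      Cmod (h (S N)) ^ 2 + Cmod (RtoC ((- a) ^ (S N)) * alpha + RtoC s * div_lin a h N)%C ^ 2).
    { clear IHN E. unfold addS, scalS, tm0, mul_mobius, addS, mul_z, scalS; fold s.
      assert (Hh : h (S N) = (div_lin a h (S N) + RtoC a * div_lin a h N)%C) by (simpl; ring).
      rewrite Hh. rewrite !Cmod_sqr. set (b := (- a) ^ S N). 
      replace ((-a) ^ (S (S N))) with (- a * b) by (unfold b; simpl; ring).
      destruct alpha as [p q], (div_lin a h N) as [u v], (div_lin a h (S N)) as [u' v']; simpl.
      ring [Hs]. }
    lra.
Qed.

(** * Weighted composition operators *)

(* The Takenaka-Malmquist basis [sqrt (1 - a^2) / (1 + a z) * phi_a^k]. *)
Definition tm_basis (a : R) (k : nat) : seqC := Nat.iter k (mul_mobius a) (tm0 a).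

Lemma div_lin_linear a c f g n :
  div_lin a (addS (scalS c f) g) n = (c * div_lin a f n + div_lin a g n)%C.
Proof.
  induction n; simpl. reflexivity. rewrite IHn. unfold addS, scalS. ring.
Qed.

Lemma mul_mobius_linear a c f g : mul_mobius a (addS (scalS c f) g) = addS (scalS c (mul_mobius a f)) (mul_mobius a g).
Proof.
  assert (E : div_lin a (addS (scalS c f) g) = addS (scalS c (div_lin a f)) (div_lin a g)).
  { apply seq_ext; intros n. apply div_lin_linear. }
  unfold mul_mobius. rewrite E. apply seq_ext; intros [|n]; unfold addS, scalS, mul_z; ring.
Qed.

Lemma mul_mobius_zero a : mul_mobius a zeroS = zeroS.
Proof.
  assert (E : forall n, div_lin a zeroS n = RtoC 0).
  { induction n; simpl. reflexivity. rewrite IHn. unfold zeroS; ring. }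
  apply seq_ext; intros n. unfold mul_mobius, addS, scalS. rewrite E.
  destruct n; simpl; rewrite ?E; unfold zeroS; ring.
Qed.

Lemma mul_mobius_fpart a q f N :
  mul_mobius a (fpart q f N) = fpart (fun k => mul_mobius a (q k)) f N.
Proof.
  unfold fpart. induction N; simpl. apply mul_mobius_zero.
  assert (Ea : forall u v, addS u v = addS v u).
  { intros; apply seq_ext; intros; unfold addS; ring. }
  now rewrite <- IHN, Ea, mul_mobius_linear, Ea.
Qed.

Lemma sum_n_front (u : nat -> R) N : sum_n u (S N) = u O + sum_n (fun n => u (S n)) N.
Proof.
  induction N. rewrite sum_n_S, !sum_n_0. reflexivity.
  rewrite sum_n_S, IHN, sum_n_S. lra.
Qed.

(** Counts terms, with an empty sum at 0, to match [vpart]; [sum_n] includes its upper index. *)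
Definition partial_normsq (f : seqC) (N : nat) : R :=
  match N with O => 0 | S n => sum_n (fun n => Cmod (f n) ^ 2) n end.

Lemma partial_normsq_S f N : partial_normsq f (S N) = Cmod (f O) ^ 2 + partial_normsq (fun n => f (S n)) N.
Proof.
  destruct N; simpl. rewrite sum_n_0. simpl; lra.
  apply (sum_n_front (fun n => Cmod (f n) ^ 2)).
Qed.

Lemma horner_le a alpha h N : Rabs a < 1 ->
  sum_n (fun n => Cmod (addS (scalS alpha (tm0 a)) (mul_mobius a h) n) ^ 2) N
  <= Cmod alpha ^ 2 + sum_n (fun n => Cmod (h n) ^ 2) N.
Proof.
  intros Ha. rewrite <- (horner_identity a alpha h N Ha).
  assert (P := pow2_ge_0 (Cmod (RtoC ((- a) ^ S N) * alpha + RtoC (unit_norm a) * div_lin a h N)%C)).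
  lra.
Qed.

(** Horner scheme: an expansion equals its first term plus [phi_a] times the expansion with shifted
    coefficients, and [horner_le] bounds each such step. *)
Lemma tm_basis_fpart_le a : Rabs a < 1 -> forall N f M,
  sum_n (fun n => Cmod (fpart (tm_basis a) f N n) ^ 2) M <= partial_normsq f N.
Proof.
  intros Ha. induction N; intros f M.
  - simpl. assert (H := proj2 normle_zero M). unfold fpart; simpl. simpl in H. lra.
  - rewrite partial_normsq_S.
    assert (E : fpart (tm_basis a) f (S N) =
      addS (scalS (f O) (tm0 a)) (mul_mobius a (fpart (tm_basis a) (fun n => f (S n)) N))).
    { rewrite mul_mobius_fpart. unfold fpart. rewrite vpart_S. reflexivity. }
    rewrite E. eapply Rle_trans. apply horner_le; auto.
    specialize (IHN (fun n => f (S n)) M). lra.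
Qed.

Lemma tm_basis_bessel a : Rabs a < 1 -> bessel (tm_basis a).
Proof.
  intros Ha f B N [HB Hf]. split; auto. intros M.
  apply Rle_trans with (1 := tm_basis_fpart_le a Ha N f M).
  destruct N; [apply pow2_ge_0|apply Hf].
Qed.

Lemma mul_mobius_normle a h B : Rabs a < 1 -> normle h B -> normle (mul_mobius a h) B.
Proof.
  intros Ha [HB H]. split; auto. intros N.
  assert (L := horner_le a 0 h N Ha). rewrite Cmod_0 in L.
  replace (addS (scalS 0 (tm0 a)) (mul_mobius a h)) with (mul_mobius a h) in L.
  specialize (H N). simpl in *; lra.
  apply seq_ext; intros; unfold addS, scalS; ring.
Qed.

(** For [alpha = 0] the boundary term of [horner_identity] is the square of [unit_norm a] times the
    modulus of the coefficient, and it is bounded by the norm of [h]. *)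
Lemma div_lin_coef_bounded a h : Rabs a < 1 -> l2 h -> coef_bounded (div_lin a h).
Proof.
  intros Ha [B [HB H]]. assert (Hs := unit_norm_pos a Ha). exists (B / unit_norm a). intros n.
  assert (L := horner_identity a 0 h n Ha). rewrite Cmod_0 in L.
  assert (P : 0 <= sum_n (fun n => Cmod (addS (scalS 0 (tm0 a)) (mul_mobius a h) n) ^ 2) n).
  { eapply Rle_trans; [|apply sum_n_pos_ge; intros; apply pow2_ge_0]. apply pow2_ge_0. }
  replace (RtoC ((- a) ^ S n) * 0 + RtoC (unit_norm a) * div_lin a h n)%C with
    (RtoC (unit_norm a) * div_lin a h n)%C in L by ring.
  rewrite Cmod_mult, Cmod_R, Rabs_pos_eq in L by lra. specialize (H n).
  assert (Q : (unit_norm a * Cmod (div_lin a h n)) ^ 2 <= B ^ 2) by (simpl in *; lra).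
  apply Rmult_le_reg_r with (unit_norm a); auto. unfold Rdiv.
  rewrite Rmult_assoc, Rinv_l, Rmult_1_r by lra.
  apply Rsqr_incr_0_var; auto. unfold Rsqr. simpl in *; lra.
Qed.

Definition mobius (a x : R) : R := (x + a) / (1 + a * x).

Lemma mobius_den a x : Rabs a < 1 -> Rabs x < 1 -> 0 < 1 + a * x.
Proof. intros Ha Hx. apply Rabs_def2 in Ha; apply Rabs_def2 in Hx. nra. Qed.

Lemma mobius_lt a x : Rabs a < 1 -> Rabs x < 1 -> Rabs (mobius a x) < 1.
Proof.
  intros Ha Hx. assert (D := mobius_den a x Ha Hx).
  apply Rabs_def2 in Ha; apply Rabs_def2 in Hx. unfold mobius.
  apply Rabs_def1; apply Rmult_lt_reg_r with (1 + a * x); auto;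
  unfold Rdiv; rewrite Rmult_assoc, Rinv_l by lra; nra.
Qed.

Lemma RtoC_neq_0 x : x <> 0 -> RtoC x <> RtoC 0.
Proof. intros H E. apply H. now injection E. Qed.

Lemma eval_mul_mobius a x h : Rabs a < 1 -> Rabs x < 1 -> l2 h ->
  eval x (mul_mobius a h) = (RtoC (mobius a x) * eval x h)%C.
Proof.
  intros Ha Hx Hh. assert (Hk := div_lin_coef_bounded a h Ha Hh). assert (D := mobius_den a x Ha Hx).
  rewrite <- (mul_lin_div_lin a h) at 2. rewrite eval_mul_lin by auto.
  unfold mul_mobius. rewrite eval_add, eval_mul_z, eval_scal; auto using coef_bounded_mul_z, coef_bounded_scal.
  rewrite Cmult_assoc, <- RtoC_mult. unfold mobius.
  replace ((x + a) / (1 + a * x) * (1 + a * x)) with (x + a) by (field; lra).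
  rewrite RtoC_plus; ring.
Qed.

Lemma tm0_normle a : Rabs a < 1 -> normle (tm0 a) 1.
Proof.
  intros Ha. assert (H := tm_basis_bessel a Ha (delta 0) 1 1%nat (normle_delta 0)).
  replace (tm0 a) with (fpart (tm_basis a) (delta 0) 1); auto.
  unfold fpart; simpl. apply seq_ext; intros; unfold addS, scalS, zeroS, delta, tm_basis; simpl; ring.
Qed.

Lemma tm_basis_l2 a k : Rabs a < 1 -> l2 (tm_basis a k).
Proof.
  intros Ha; exists 1; induction k; simpl. now apply tm0_normle. now apply mul_mobius_normle.
Qed.

Lemma mul_lin_tm0 a : mul_lin a (tm0 a) = scalS (RtoC (unit_norm a)) (delta 0).
Proof.
  apply seq_ext; intros [|n]; unfold mul_lin, addS, scalS, mul_z, tm0, delta;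
  apply injective_projections; simpl; ring.
Qed.

Lemma eval_tm_basis a x k : Rabs a < 1 -> Rabs x < 1 ->
  eval x (tm_basis a k) = RtoC (unit_norm a / (1 + a * x) * mobius a x ^ k).
Proof.
  intros Ha Hx. assert (D := mobius_den a x Ha Hx). induction k.
  - simpl.
    assert (E' : eval x (mul_lin a (tm0 a)) = RtoC (unit_norm a)).
    { rewrite mul_lin_tm0, eval_scal, eval_delta; auto. simpl; ring. apply l2_coef_bounded; eexists; apply normle_delta. }
    rewrite eval_mul_lin in E'; auto. 2: apply l2_coef_bounded; eexists; now apply tm0_normle.
    rewrite Rmult_1_r. unfold Rdiv. rewrite RtoC_mult, <- E', RtoC_inv by lra.
    field. apply RtoC_neq_0; lra.
  - change (tm_basis a (S k)) with (mul_mobius a (tm_basis a k)).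
    rewrite eval_mul_mobius, IHk, <- RtoC_mult; auto using tm_basis_l2. f_equal; simpl; ring.
Qed.

(** The operator [W] at [a]. Sending the monomial [z^k] to the k-th Takenaka-Malmquist function
    turns its contractivity into a Bessel inequality; the closed form is recovered in
    [eval_wcomp]. *)
Definition wcomp (a : R) : op := synthesis (tm_basis a).

Lemma wcomp_bounded a : Rabs a < 1 -> bounded_l2 (wcomp a) 1.
Proof. intros; apply synthesis_bounded; now apply tm_basis_bessel. Qed.

Lemma eval_fpart x q f N : Rabs x < 1 -> (forall k, l2 (q k)) ->
  eval x (fpart q f (S N)) = (eval x (fpart q f N) + f N * eval x (q N))%C.
Proof.
  intros Hx Hq. unfold fpart. rewrite eval_vpart, eval_scal; auto.
  now apply l2_coef_bounded. intros; now apply l2_scal.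
Qed.

Lemma l2_fpart q f N : (forall k, l2 (q k)) -> l2 (fpart q f N).
Proof. intros; apply l2_vpart; intros; now apply l2_scal. Qed.

Lemma l2_delta k : l2 (delta k).
Proof. exists 1; apply normle_delta. Qed.

(** The formula is clear for monomials. Both sides are limits along partial sums, on the left in the
    Takenaka-Malmquist system at [x], on the right in monomials at [mobius a x]. *)
Lemma eval_wcomp a x f : Rabs a < 1 -> Rabs x < 1 -> l2 f ->
  eval x (wcomp a f) = (RtoC (unit_norm a / (1 + a * x)) * eval (mobius a x) f)%C.
Proof.
  intros Ha Hx Hf. assert (Hy := mobius_lt a x Ha Hx).
  assert (He : forall k, l2 (tm_basis a k)) by (intros; now apply tm_basis_l2).
  apply Clim_unique with (fun N => eval x (fpart (tm_basis a) f N)).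
  - apply conv_eval; auto. intros; now apply l2_fpart.
    apply synthesis_conv; auto. now apply tm_basis_bessel.
  - eapply Clim_ext; [|apply Clim_scal; apply conv_eval with (s := fpart delta f); auto].
    + intros N; simpl. induction N.
      * unfold fpart; simpl. rewrite !eval_zero; ring.
      * rewrite !eval_fpart, <- IHN, eval_tm_basis, eval_delta, RtoC_mult; auto using l2_delta. ring.
    + intros; apply l2_fpart, l2_delta.
    + now apply fpart_delta_conv.
Qed.

(** Composition with [phi_a], obtained by cancelling the weight of [wcomp]; boundedness on [H^2] is
    inherited in this way. *)
Definition comp (a : R) : op := fun f => scalS (RtoC (/ unit_norm a)) (mul_lin a (wcomp a f)).

Lemma comp_bounded a : Rabs a < 1 -> exists K, bounded_l2 (comp a) K.
Proof.
  intros Ha. eexists. apply bounded_scal.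
  apply (bounded_comp (mul_lin a) (wcomp a)); [apply mul_lin_bounded|now apply wcomp_bounded].
Qed.

Lemma wcomp_l2 a f : Rabs a < 1 -> l2 f -> l2 (wcomp a f).
Proof. intros Ha; apply bounded_maps_l2 with 1; now apply wcomp_bounded. Qed.

Lemma mul_lin_l2 c f : l2 f -> l2 (mul_lin c f).
Proof. eapply bounded_maps_l2, mul_lin_bounded. Qed.

Lemma comp_l2 a f : Rabs a < 1 -> l2 f -> l2 (comp a f).
Proof. intros Ha Hf. apply l2_scal, mul_lin_l2, wcomp_l2; auto. Qed.

Lemma eval_comp a x f : Rabs a < 1 -> Rabs x < 1 -> l2 f ->
  eval x (comp a f) = eval (mobius a x) f.
Proof.
  intros Ha Hx Hf. assert (D := mobius_den a x Ha Hx). assert (P := unit_norm_pos a Ha).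
  assert (Hw : l2 (wcomp a f)) by now apply wcomp_l2.
  unfold comp. rewrite eval_scal, eval_mul_lin, eval_wcomp; auto using l2_coef_bounded.
  2: now apply l2_coef_bounded, mul_lin_l2.
  rewrite !Cmult_assoc, <- !RtoC_mult.
  replace (/ unit_norm a * (1 + a * x) * (unit_norm a / (1 + a * x))) with 1 by (field; lra). ring.
Qed.

Lemma l2_inj f g : l2 f -> l2 g -> (forall x, Rabs x < 1 -> eval x f = eval x g) -> f = g.
Proof. intros; apply eval_inj; auto using l2_coef_bounded. Qed.

Lemma mobius_inv a x : Rabs a < 1 -> Rabs x < 1 -> mobius a (mobius (- a) x) = x.
Proof.
  intros Ha Hx. assert (Ha' : Rabs (- a) < 1) by now rewrite Rabs_Ropp.
  assert (D := mobius_den (-a) x Ha' Hx).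
  assert (D' := mobius_den a _ Ha (mobius_lt (-a) x Ha' Hx)).
  unfold mobius in *. apply Rabs_def2 in Ha. field. 
  assert (1 - a * a > 0) by nra. split; [lra|].
  replace (1 + - a * x + a * (x + - a)) with (1 - a * a) by ring. lra.
Qed.

Lemma unit_norm_opp a : unit_norm (- a) = unit_norm a.
Proof. unfold unit_norm. f_equal; ring. Qed.

Lemma wcomp_inv a f : Rabs a < 1 -> l2 f -> wcomp a (wcomp (- a) f) = f.
Proof.
  intros Ha Hf. assert (Ha' : Rabs (- a) < 1) by now rewrite Rabs_Ropp.
  apply l2_inj; auto using wcomp_l2. intros x Hx. assert (P := unit_norm_sqr a Ha).
  assert (D := mobius_den a x Ha Hx). assert (D' := mobius_den (-a) _ Ha' (mobius_lt a x Ha Hx)).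
  rewrite !eval_wcomp; auto using wcomp_l2, mobius_lt.
  assert (M := mobius_inv (-a) x Ha' Hx). rewrite Ropp_involutive in M. rewrite M.
  rewrite Cmult_assoc, <- RtoC_mult, unit_norm_opp.
  replace (unit_norm a / (1 + a * x) * (unit_norm a / (1 + - a * mobius a x))) with 1. ring.
  apply Rabs_def2 in Ha. assert (1 - a * a > 0) by nra.
  unfold mobius in *. replace (unit_norm a / (1 + a * x) * (unit_norm a / (1 + - a * ((x + a) / (1 + a * x)))))
    with ((unit_norm a * unit_norm a) / (1 - a * a)). rewrite P; field; lra.
  field. repeat split; try lra.
Qed.

(** * Intertwining with multiplication by 1 + z and 1 - z *)

Definition kap (a : R) : R := sqrt ((1 - a) / (1 + a)).

Lemma kap_pos a : Rabs a < 1 -> 0 < kap a.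
Proof. intros H. apply Rabs_def2 in H. apply sqrt_lt_R0, Rdiv_lt_0_compat; lra. Qed.

Lemma kap_sqr a : Rabs a < 1 -> kap a * kap a = (1 - a) / (1 + a).
Proof.
  intros H. apply Rabs_def2 in H. apply sqrt_sqrt. left. apply Rdiv_lt_0_compat; lra.
Qed.

Lemma kap_unit_norm a : Rabs a < 1 -> unit_norm a = kap a * (1 + a).
Proof.
  intros H. assert (H' := Rabs_def2 _ _ H).
  apply Rsqr_inj. left; now apply unit_norm_pos.
  assert (P := kap_pos a H). nra.
  unfold Rsqr. rewrite unit_norm_sqr by auto.
  replace (kap a * (1 + a) * (kap a * (1 + a))) with ((kap a * kap a) * (1+a)*(1+a)) by ring.
  rewrite kap_sqr by auto. field; lra.
Qed.

(** Because [1 - phi_a(z) = (1 - a) (1 - z) / (1 + a z)] and [(1 - a) / sqrt (1 - a^2) = kap a]. It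
    is applied at [- r], where [kap] becomes its inverse. *)
Lemma comp_mul_lin_m a f : Rabs a < 1 -> l2 f ->
  comp a (mul_lin (-1) f) = scalS (RtoC (kap a)) (mul_lin (-1) (wcomp a f)).
Proof.
  intros Ha Hf. apply l2_inj.
  - apply comp_l2; auto. now apply mul_lin_l2.
  - apply l2_scal, mul_lin_l2, wcomp_l2; auto.
  - intros x Hx. assert (D := mobius_den a x Ha Hx). assert (K := kap_pos a Ha).
    assert (Q := kap_sqr a Ha).
    rewrite eval_comp, eval_scal, !eval_mul_lin, eval_wcomp; auto using mobius_lt, l2_coef_bounded, wcomp_l2, mul_lin_l2, coef_bounded_mul_lin.
    rewrite !Cmult_assoc, <- !RtoC_mult. f_equal. f_equal. unfold mobius.
    rewrite (kap_unit_norm a Ha). apply Rabs_def2 in Ha.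
    replace (kap a * (1 + -1 * x) * (kap a * (1 + a) / (1 + a * x))) with
     ((kap a * kap a) * (1 - x) * (1 + a) / (1 + a * x)) by (field; lra).
    rewrite Q. field; lra.
Qed.

(** Because [1 + phi_a(z) = (1 + a) (1 + z) / (1 + a z)] and
    [(1 + a) / sqrt (1 - a^2) = / kap a]. *)
Lemma comp_mul_lin_p a f : Rabs a < 1 -> l2 f ->
  comp a (mul_lin 1 f) = scalS (RtoC (/ kap a)) (mul_lin 1 (wcomp a f)).
Proof.
  intros Ha Hf. apply l2_inj.
  - apply comp_l2; auto. now apply mul_lin_l2.
  - apply l2_scal, mul_lin_l2, wcomp_l2; auto.
  - intros x Hx. assert (D := mobius_den a x Ha Hx). assert (K := kap_pos a Ha).
    rewrite eval_comp, eval_scal, !eval_mul_lin, eval_wcomp; auto using mobius_lt, l2_coef_bounded, wcomp_l2, mul_lin_l2, coef_bounded_mul_lin.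
    rewrite !Cmult_assoc, <- !RtoC_mult. f_equal. f_equal. unfold mobius.
    rewrite (kap_unit_norm a Ha). field; lra.
Qed.

Lemma comp_comp a b c f : Rabs a < 1 -> Rabs b < 1 -> Rabs c < 1 ->
  (forall x, Rabs x < 1 -> mobius b (mobius a x) = mobius c x) -> l2 f ->
  comp a (comp b f) = comp c f.
Proof.
  intros Ha Hb Hc H Hf. apply l2_inj; auto using comp_l2. intros x Hx.
  rewrite !eval_comp; auto using comp_l2, mobius_lt. now rewrite H.
Qed.

(** * Resolvents and the kernel *)

Lemma kap_opp a : Rabs a < 1 -> kap (- a) = / kap a.
Proof.
  intros H. apply Rabs_def2 in H. unfold kap. rewrite <- sqrt_inv. f_equal. field; lra.
Qed.

Definition scaled (c : C) (T : op) : op := fun f => scalS c (T f).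

Lemma scaled_wcomp_bounded c a : Rabs a < 1 -> bounded_l2 (scaled c (wcomp a)) (Cmod c).
Proof.
  intros Ha. apply bounded_ext with (Cmod c * 1); [|ring]. now apply bounded_scal, wcomp_bounded.
Qed.

Section Annulus.
Variables (r : R) (lam : C).
Hypothesis Hr : Rabs r < 1.
Hypothesis Hlam : kap r < Cmod lam < / kap r.

Lemma Rabs_opp_lt : Rabs (- r) < 1.
Proof. now rewrite Rabs_Ropp. Qed.

Lemma lam_neq_0 : lam <> 0.
Proof.
  intros E. rewrite E, Cmod_0 in Hlam. assert (H := kap_pos r Hr). lra.
Qed.

(** The ratios come from [kap W - lam = - lam (I - (kap / lam) W)] and [kap^-1 W - lam = kap^-1 W (I
    - lam kap W^-1)], where [W] is taken at [- r] and its inverse at [r]. The two bounds of the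
    annulus say exactly that both have modulus below 1. *)
Definition ratio_plus : C := (RtoC (kap r) / lam)%C.
Definition ratio_minus : C := (lam * RtoC (kap r))%C.

Lemma ratio_plus_lt : Cmod ratio_plus < 1.
Proof.
  assert (H := kap_pos r Hr). unfold ratio_plus. rewrite Cmod_div by apply lam_neq_0.
  rewrite Cmod_R, Rabs_pos_eq by lra.
  apply Rmult_lt_reg_r with (Cmod lam); [lra|]. unfold Rdiv. rewrite Rmult_assoc, Rinv_l; lra.
Qed.

Lemma ratio_minus_lt : Cmod ratio_minus < 1.
Proof.
  assert (H := kap_pos r Hr). unfold ratio_minus. rewrite Cmod_mult, Cmod_R, Rabs_pos_eq by lra.
  apply Rmult_lt_reg_r with (/ kap r); [now apply Rinv_0_lt_compat|].
  rewrite Rmult_assoc, Rinv_r; lra.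
Qed.

Definition neu_plus : op := neumann (scaled ratio_plus (wcomp (- r))).
Definition neu_minus : op := neumann (scaled ratio_minus (wcomp r)).

Lemma neu_plus_bounded : bounded_l2 neu_plus (/ (1 - Cmod ratio_plus)).
Proof. apply neumann_bounded. apply scaled_wcomp_bounded, Rabs_opp_lt. apply ratio_plus_lt. Qed.
Lemma neu_minus_bounded : bounded_l2 neu_minus (/ (1 - Cmod ratio_minus)).
Proof. apply neumann_bounded. now apply scaled_wcomp_bounded. apply ratio_minus_lt. Qed.

Definition res_plus : op := scaled (- / lam)%C neu_plus.
Definition res_minus : op := scaled (RtoC (kap r)) (fun f => wcomp r (neu_minus f)).

Lemma res_plus_bounded : exists K, bounded_l2 res_plus K.
Proof. eexists. apply bounded_scal, neu_plus_bounded. Qed.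
Lemma res_minus_bounded : exists K, bounded_l2 res_minus K.
Proof. eexists. apply bounded_scal, (bounded_comp (wcomp r) neu_minus). now apply wcomp_bounded. apply neu_minus_bounded. Qed.

Lemma res_plus_l2 f : l2 f -> l2 (res_plus f).
Proof. destruct res_plus_bounded as [K HK]. now apply bounded_maps_l2 with K. Qed.
Lemma res_minus_l2 f : l2 f -> l2 (res_minus f).
Proof. destruct res_minus_bounded as [K HK]. now apply bounded_maps_l2 with K. Qed.

Lemma kap_neq_0 : RtoC (kap r) <> 0.
Proof. apply RtoC_neq_0. assert (H := kap_pos r Hr). lra. Qed.

Lemma res_plus_eq f : l2 f ->
  scalS (RtoC (kap r)) (wcomp (- r) (res_plus f)) = addS f (scalS lam (res_plus f)).
Proof.
  intros Hf. assert (Hl := lam_neq_0).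
  assert (E := neumann_eq _ _ f (scaled_wcomp_bounded ratio_plus (- r) Rabs_opp_lt) ratio_plus_lt Hf).
  fold neu_plus in E.
  unfold res_plus, scaled. rewrite (proj2 (proj1 (wcomp_bounded (- r) Rabs_opp_lt))).
  2: apply bounded_maps_l2 with (2 := Hf) (1 := neu_plus_bounded).
  apply seq_ext; intros n. apply (f_equal (fun g => g n)) in E.
  unfold scaled, scalS, subS, addS, ratio_plus in *.
  replace (RtoC (kap r) * (- / lam * wcomp (- r) (neu_plus f) n))%C with
    (- (RtoC (kap r) / lam * wcomp (- r) (neu_plus f) n))%C by (field; auto).
  rewrite E. field; auto.
Qed.

(** [lam * res_minus] is the Neumann series without its first term. In [kernel_nonzero] this also
    gives the value of [res_minus] at 0. *)
Lemma neu_minus_W f : l2 f -> scalS lam (res_minus f) = subS (neu_minus f) f.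
Proof.
  intros Hf. unfold neu_minus. rewrite <- (neumann_eq _ _ f (scaled_wcomp_bounded ratio_minus r Hr) ratio_minus_lt Hf).
  fold neu_minus. apply seq_ext; intros n. unfold res_minus, scaled, scalS, ratio_minus. ring.
Qed.

Lemma res_minus_eq f : l2 f ->
  scalS (RtoC (/ kap r)) (wcomp (- r) (res_minus f)) = addS f (scalS lam (res_minus f)).
Proof.
  intros Hf. assert (Hl := lam_neq_0). assert (Hk := kap_neq_0). assert (P := kap_pos r Hr).
  assert (HN : l2 (neu_minus f)) by apply bounded_maps_l2 with (2 := Hf) (1 := neu_minus_bounded).
  rewrite neu_minus_W by auto.
  unfold res_minus, scaled. rewrite (proj2 (proj1 (wcomp_bounded (- r) Rabs_opp_lt))).
  2: now apply wcomp_l2.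
  assert (I := wcomp_inv (- r) (neu_minus f) Rabs_opp_lt HN). rewrite Ropp_involutive in I. rewrite I.
  apply seq_ext; intros n. unfold scalS, addS, subS. rewrite RtoC_inv by lra. field; auto.
Qed.

(** [C - lam] sends the two summands to [(1 + z) f] and [(1 - z) f], whose sum is [2 f]. *)
Definition right_inv : op := fun f =>
  scalS (/ 2) (addS (mul_lin 1 (res_plus f)) (mul_lin (-1) (res_minus f))).

Lemma right_inv_bounded : exists K, bounded_l2 right_inv K.
Proof.
  destruct res_plus_bounded as [K1 H1], res_minus_bounded as [K2 H2]. eexists.
  apply bounded_scal, (bounded_add (fun f => mul_lin 1 (res_plus f)) (fun f => mul_lin (-1) (res_minus f)));
  apply (bounded_comp (mul_lin _)); try apply mul_lin_bounded; eauto.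
Qed.

Lemma comp_p f : l2 f ->
  comp (- r) (mul_lin 1 f) = mul_lin 1 (scalS (RtoC (kap r)) (wcomp (- r) f)).
Proof.
  intros Hf. rewrite comp_mul_lin_p, kap_opp, Rinv_inv; auto using Rabs_opp_lt.
  symmetry. apply (proj2 (proj1 (mul_lin_bounded 1))). apply wcomp_l2; auto using Rabs_opp_lt.
Qed.

Lemma comp_m f : l2 f ->
  comp (- r) (mul_lin (-1) f) = mul_lin (-1) (scalS (RtoC (/ kap r)) (wcomp (- r) f)).
Proof.
  intros Hf. rewrite comp_mul_lin_m, kap_opp; auto using Rabs_opp_lt.
  symmetry. apply (proj2 (proj1 (mul_lin_bounded (-1)))). apply wcomp_l2; auto using Rabs_opp_lt.
Qed.

Lemma comp_linear : linear_l2 (comp (- r)).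
Proof. destruct (comp_bounded (- r) Rabs_opp_lt) as [K HK]. apply HK. Qed.

Lemma mul_lin_add c f g : mul_lin c (addS f g) = addS (mul_lin c f) (mul_lin c g).
Proof. apply seq_ext; intros [|n]; unfold mul_lin, addS, scalS, mul_z; ring. Qed.
Lemma mul_lin_scal c d f : mul_lin c (scalS d f) = scalS d (mul_lin c f).
Proof. apply seq_ext; intros [|n]; unfold mul_lin, addS, scalS, mul_z; ring. Qed.

Lemma comp_res_plus f : l2 f ->
  comp (- r) (mul_lin 1 (res_plus f)) = addS (mul_lin 1 f) (scalS lam (mul_lin 1 (res_plus f))).
Proof.
  intros Hf. rewrite comp_p, res_plus_eq, mul_lin_add, mul_lin_scal; auto using res_plus_l2.
Qed.
Lemma comp_res_minus f : l2 f ->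
  comp (- r) (mul_lin (-1) (res_minus f)) = addS (mul_lin (-1) f) (scalS lam (mul_lin (-1) (res_minus f))).
Proof.
  intros Hf. rewrite comp_m, res_minus_eq, mul_lin_add, mul_lin_scal; auto using res_minus_l2.
Qed.

Lemma right_inv_spec f : l2 f ->
  subS (comp (- r) (right_inv f)) (scalS lam (right_inv f)) = f.
Proof.
  intros Hf. unfold right_inv. destruct comp_linear as [KA KS].
  rewrite KS, KA, comp_res_plus, comp_res_minus; auto using l2_add, mul_lin_l2, res_plus_l2, res_minus_l2.
  apply seq_ext; intros n. unfold subS, scalS, addS.
  assert (E : (mul_lin 1 f n + mul_lin (-1) f n)%C = (2 * f n)%C).
  { destruct n; unfold mul_lin, addS, scalS, mul_z; rewrite ?RtoC_opp; ring. }
  replace (f n) with (/ 2 * (mul_lin 1 f n + mul_lin (-1) f n))%C.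
  ring. rewrite E. field.
Qed.

(** [C - lam] sends both terms to [(1 - z^2) f], because the two multiplications commute. *)
Definition kernel_map : op := fun f =>
  subS (mul_lin 1 (res_plus (mul_lin (-1) f))) (mul_lin (-1) (res_minus (mul_lin 1 f))).

Lemma kernel_map_l2 f : l2 f -> l2 (kernel_map f).
Proof. intros; apply l2_sub; auto using mul_lin_l2, res_plus_l2, res_minus_l2. Qed.

Lemma kernel_map_eigen f : l2 f -> comp (- r) (kernel_map f) = scalS lam (kernel_map f).
Proof.
  intros Hf. unfold kernel_map.
  rewrite linear_sub, comp_res_plus, comp_res_minus; auto using mul_lin_l2, res_plus_l2, res_minus_l2, comp_linear.
  apply seq_ext; intros n. unfold subS, scalS, addS.
  assert (E : mul_lin 1 (mul_lin (-1) f) n = mul_lin (-1) (mul_lin 1 f) n).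
  { destruct n as [|[|n]]; unfold mul_lin, addS, scalS, mul_z; rewrite ?RtoC_opp; ring. }
  rewrite E; ring.
Qed.
End Annulus.

(* The quantity [sqrt (1 - x^2) * |h x|] is transported by [W] along the orbit of [x] under [phi_a],
   because [1 - phi_a(x)^2 = (1 - a^2) (1 - x^2) / (1 + a x)^2]. *)
Lemma orbit_value a c h : Rabs a < 1 -> l2 h -> forall k x, Rabs x < 1 -> 0 <= a * x ->
  exists y, Rabs y < 1 /\ 1 - y ^ 2 <= (1 - a ^ 2) ^ k * (1 - x ^ 2) /\
  sqrt (1 - x ^ 2) * Cmod (eval x (Nat.iter k (scaled c (wcomp a)) h)) =
  Cmod c ^ k * (sqrt (1 - y ^ 2) * Cmod (eval y h)).
Proof.
  intros Ha Hh. induction k; intros x Hx Hax.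
  - exists x. simpl. split; auto. split; lra.
  - assert (D := mobius_den a x Ha Hx). assert (P := unit_norm_sqr a Ha). assert (Sp := unit_norm_pos a Ha).
    assert (Hy := mobius_lt a x Ha Hx).
    assert (Q : 1 - mobius a x ^ 2 = (1 - a ^ 2) * (1 - x ^ 2) / (1 + a * x) ^ 2)
      by (unfold mobius; field; lra).
    assert (X2 : 0 <= 1 - x ^ 2) by (apply Rabs_def2 in Hx; nra).
    assert (A2 : 0 <= 1 - a ^ 2) by (apply Rabs_def2 in Ha; nra).
    (* The outermost [W] moves the evaluation point to [mobius a x]. The condition [0 <= a * x]
       passes to that point and keeps [1 + a x >= 1], so each step shrinks [1 - x^2] at least by the
       factor [1 - a^2]. *)
    destruct (IHk (mobius a x)) as (y & Y1 & Y2 & Y3); auto.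
    { unfold mobius. replace (a * ((x + a) / (1 + a * x))) with ((a * x + a * a) * / (1 + a * x))
        by (field; lra). apply Rmult_le_pos; [nra|]. left; now apply Rinv_0_lt_compat. }
    exists y. split; auto. split.
    + eapply Rle_trans. apply Y2. simpl. rewrite Rmult_assoc.
      rewrite (Rmult_comm (1 - a * (a * 1))), Rmult_assoc.
      apply Rmult_le_compat_l. apply pow_le. simpl in *; lra.
      change (mobius a x * (mobius a x * 1)) with (mobius a x ^ 2). rewrite Q.
      replace ((1 - x * (x * 1)) * (1 - a * (a * 1))) with ((1 - a ^ 2) * (1 - x ^ 2)) by ring.
      apply Rle_trans with ((1 - a ^ 2) * (1 - x ^ 2) / 1); [|lra].
      unfold Rdiv. apply Rmult_le_compat_l. nra.
      apply Rinv_le_contravar; nra.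
    + simpl Nat.iter. unfold scaled at 1.
      assert (Hi : l2 (Nat.iter k (scaled c (wcomp a)) h)).
      { apply (bounded_maps_l2 _ _ _ (bounded_iter _ _ k (scaled_wcomp_bounded c a Ha)) Hh). }
      rewrite eval_scal, eval_wcomp by auto using l2_coef_bounded, wcomp_l2.
      rewrite !Cmod_mult, Cmod_R, Rabs_pos_eq.
      2:{ apply Rmult_le_pos; [lra|]. left; now apply Rinv_0_lt_compat. }
      simpl pow at 2. rewrite Rmult_assoc, <- Y3.
      replace (sqrt (1 - mobius a x ^ 2)) with (sqrt (1 - x ^ 2) * (unit_norm a / (1 + a * x))).
      ring.
      symmetry. apply Rsqr_inj. apply sqrt_pos.
      apply Rmult_le_pos. apply sqrt_pos. apply Rmult_le_pos; [lra|]. left; now apply Rinv_0_lt_compat.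
      assert (Hm : 0 <= 1 - mobius a x ^ 2) by (apply Rabs_def2 in Hy; nra).
      rewrite Rsqr_sqrt by auto. rewrite Rsqr_mult, Rsqr_sqrt by auto. rewrite Q.
      unfold Rsqr. replace (unit_norm a / (1 + a * x) * (unit_norm a / (1 + a * x))) with
        ((unit_norm a * unit_norm a) / (1 + a * x) ^ 2) by (field; lra). rewrite P. field; lra.
Qed.

(** At 0 the first term of the series is [h O]. Every later term samples [h] at a point reached from
    0 after at least one step, where [1 - y^2 <= 1 - a^2]; this leaves a geometric series of ratio
    [Cmod c]. *)
Lemma neumann_0 a c h D : Rabs a < 1 -> Cmod c < 1 -> l2 h -> 0 <= D ->
  (forall y, Rabs y < 1 -> 1 - y ^ 2 <= 1 - a ^ 2 -> Cmod (eval y h) <= D) ->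
  Cmod (neumann (scaled c (wcomp a)) h O - h O)%C <= D / (1 - Cmod c).
Proof.
  intros Ha Hc Hh HD H. set (T := scaled c (wcomp a)).
  assert (Hc0 := Cmod_ge_0 c).
  assert (HT := scaled_wcomp_bounded c a Ha). fold T in HT.
  assert (Hk : forall k, Cmod (Nat.iter (S k) T h O) <= Cmod c ^ (S k) * D).
  { intros k. destruct (orbit_value a c h Ha Hh (S k) 0) as (y & Y1 & Y2 & Y3).
    rewrite Rabs_R0; lra. lra.
    rewrite eval_0 in Y3. fold T in Y3. replace (1 - 0 ^ 2) with 1 in * by ring.
    rewrite sqrt_1, Rmult_1_l in Y3. rewrite Y3.
    apply Rmult_le_compat_l. now apply pow_le.
    assert (S1 : sqrt (1 - y ^ 2) <= 1).
    { rewrite <- sqrt_1 at 2. apply sqrt_le_1_alt. assert (Q := pow2_ge_0 y); lra. }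
    assert (S0 := sqrt_pos (1 - y ^ 2)).
    assert (A2 : 0 <= 1 - a ^ 2 <= 1).
    { assert (Q := pow2_ge_0 a). apply Rabs_def2 in Ha; nra. }
    assert (E : Cmod (eval y h) <= D).
    { apply H; auto. rewrite Rmult_1_r in Y2. simpl in Y2.
      assert (Q : 0 <= (1 - a * (a * 1)) ^ k <= 1).
      { split. apply pow_le; simpl in A2; lra. apply Rle_trans with (1 ^ k); [apply pow_incr; simpl in A2; lra|rewrite pow1; lra]. }
      simpl in *; nra. }
    assert (E0 := Cmod_ge_0 (eval y h)). nra. }
  (* The right side is [D] times [q + ... + q^N] with [q = Cmod c]: the partial sum of length [S N]
     contains the powers 0 to [N], and the power 0 cancels against [h O]. *)
  assert (HN : forall N, Cmod (vpart (fun k => Nat.iter k T h) (S N) O - h O)%C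
    <= D / (1 - Cmod c) * (Cmod c - Cmod c ^ (S N))).
  { induction N.
    - simpl. unfold addS, zeroS. replace (0 + h O - h O)%C with (RtoC 0) by ring.
      rewrite Cmod_0. lra.
    - change (vpart (fun k => Nat.iter k T h) (S (S N))) with
       (addS (vpart (fun k => Nat.iter k T h) (S N)) (Nat.iter (S N) T h)).
      unfold addS.
      match goal with |- Cmod (?u + ?v - ?w)%C <= _ =>
        replace (u + v - w)%C with ((u - w) + v)%C by ring end.
      eapply Rle_trans. apply Cmod_triangle. specialize (Hk N).
      replace (D / (1 - Cmod c) * (Cmod c - Cmod c ^ S (S N))) with
        (D / (1 - Cmod c) * (Cmod c - Cmod c ^ S N) + Cmod c ^ S N * D).
      lra. simpl; field; lra. }
  assert (L := neumann_conv T _ h HT Hc Hh). apply conv_coord with (n := O) in L.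
  apply le_epsilon. intros e He. destruct (L e He) as [N HN'].
  specialize (HN' (S N) ltac:(lia)). specialize (HN N).
  set (v := vpart (fun k => Nat.iter k T h) (S N) O) in *.
  replace (neumann T h O - h O)%C with (- (v - neumann T h O) + (v - h O))%C by ring.
  eapply Rle_trans. apply Cmod_triangle. rewrite Cmod_opp.
  assert (0 <= D / (1 - Cmod c)).
  { apply Rmult_le_pos; [lra|]. left; apply Rinv_0_lt_compat; lra. }
  assert (0 <= Cmod c ^ S N) by now apply pow_le.
  nra.
Qed.

(** * The kernel is non-zero and infinite-dimensional *)

(** The polynomial [(1 - z^2)^j]: it is 1 at 0, yet at most [(1 - r^2)^j] at the real points of the
    disc with [1 - y^2 <= 1 - r^2], among them the later orbit points of 0. *)
Definition bump (j : nat) : seqC := Nat.iter j (fun f => mul_lin 1 (mul_lin (-1) f)) (delta 0).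

Lemma bump_l2 j : l2 (bump j).
Proof. induction j; simpl. apply l2_delta. now apply mul_lin_l2, mul_lin_l2. Qed.

Lemma eval_bump x j : Rabs x < 1 -> eval x (bump j) = RtoC ((1 - x ^ 2) ^ j).
Proof.
  intros Hx; induction j. simpl. now rewrite eval_delta.
  change (bump (S j)) with (mul_lin 1 (mul_lin (-1) (bump j))).
  rewrite !eval_mul_lin, IHj, <- !RtoC_mult; auto using coef_bounded_mul_lin, l2_coef_bounded, bump_l2.
  f_equal; simpl; ring.
Qed.

(** Let [n1], [n2] be the values at 0 of the two Neumann series for a bump. Then [lam] times the
    value of [kernel_map] at 0 is [1 - n1 - n2], and both [n1] and [n2] are close to 1. *)
Lemma kernel_nonzero r lam : Rabs r < 1 -> 0 < r -> kap r < Cmod lam < / kap r ->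
  exists g, l2 g /\ comp (- r) g = scalS lam g /\ g <> zeroS.
Proof.
  intros Hr Hr0 Hlam.
  assert (L1 := ratio_plus_lt r lam Hr Hlam). assert (L2 := ratio_minus_lt r lam Hr Hlam).
  assert (Hl := lam_neq_0 r lam Hr Hlam).
  assert (Hr1 : r < 1) by (apply Rabs_def2 in Hr; lra).
  (* [d * m] will bound the sum of the two errors given by [neumann_0]; the factor 2 is the bound
     for [1 + c y]. *)
  set (m := 2 / (1 - Cmod (ratio_plus r lam)) + 2 / (1 - Cmod (ratio_minus r lam))).
  assert (Hm : 0 < m).
  { apply Rplus_lt_0_compat; apply Rdiv_lt_0_compat; lra. }
  assert (Hq : Rabs (1 - r ^ 2) < 1) by (rewrite Rabs_pos_eq; nra).
  destruct (pow_lt_1_zero _ Hq (/ m)) as [j Hj]. now apply Rinv_0_lt_compat.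
  specialize (Hj j (le_n j)). set (d := (1 - r ^ 2) ^ j) in *.
  assert (Hd : 0 <= d) by (apply pow_le; nra). rewrite Rabs_pos_eq in Hj by auto.
  exists (kernel_map r lam (bump j)). split; [|split].
  - apply kernel_map_l2; auto. apply bump_l2.
  - apply kernel_map_eigen; auto. apply bump_l2.
  - intros E. apply (f_equal (fun f => f O)) in E. unfold zeroS, kernel_map, subS in E.
    assert (M0 : forall c f, mul_lin c f O = f O).
    { intros; unfold mul_lin, addS, scalS, mul_z; ring. }
    rewrite !M0 in E.
    assert (B0 : bump j O = RtoC 1).
    { rewrite <- eval_0, eval_bump. replace (1 - 0 ^ 2) with 1 by ring. now rewrite pow1.
      rewrite Rabs_R0; lra. }
    assert (Hev : forall c y, Rabs c <= 1 -> Rabs y < 1 -> 1 - y ^ 2 <= 1 - r ^ 2 ->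
      Cmod (eval y (mul_lin c (bump j))) <= 2 * d).
    { intros c y Hc Hy Hle. rewrite eval_mul_lin, eval_bump, <- RtoC_mult, Cmod_R, Rabs_mult;
       auto using l2_coef_bounded, bump_l2.
      apply Rmult_le_compat; try apply Rabs_pos.
      - eapply Rle_trans. apply Rabs_triang. rewrite Rabs_R1, Rabs_mult.
        assert (P1 := Rabs_pos c). assert (P2 := Rabs_pos y). nra.
      - rewrite Rabs_pos_eq. apply pow_incr. split; auto. apply Rabs_def2 in Hy; nra.
        apply pow_le. apply Rabs_def2 in Hy; nra. }
    assert (A1 : Cmod (neu_plus r lam (mul_lin (-1) (bump j)) O - 1)%C <= 2 * d / (1 - Cmod (ratio_plus r lam))).
    { replace (RtoC 1) with (mul_lin (-1) (bump j) O) by now rewrite M0.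
      apply neumann_0; auto using mul_lin_l2, bump_l2; [now rewrite Rabs_Ropp|lra|].
      intros y Hy Hle. apply Hev; auto. rewrite Rabs_left; lra. 
      replace ((- r) ^ 2) with (r ^ 2) in Hle by ring. auto. }
    assert (A2 : Cmod (neu_minus r lam (mul_lin 1 (bump j)) O - 1)%C <= 2 * d / (1 - Cmod (ratio_minus r lam))).
    { replace (RtoC 1) with (mul_lin 1 (bump j) O) by now rewrite M0.
      apply neumann_0; auto using mul_lin_l2, bump_l2; [lra|].
      intros y Hy Hle. apply Hev; auto. rewrite Rabs_R1; lra. }
    assert (E2 := f_equal (fun f => f O) (neu_minus_W r lam Hr Hlam (mul_lin 1 (bump j))
      (mul_lin_l2 _ _ (bump_l2 j)))).
    unfold scalS, subS in E2. rewrite M0, B0 in E2.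
    unfold res_plus, scaled, scalS in E.
    set (n1 := neu_plus r lam (mul_lin (-1) (bump j)) O) in *.
    set (n2 := neu_minus r lam (mul_lin 1 (bump j)) O) in *.
    set (t := res_minus r lam (mul_lin 1 (bump j)) O) in *.
    assert (E3 : (RtoC 1 = - (n1 - 1) + - (n2 - 1))%C).
    { rewrite <- E2. replace t with (- / lam * n1)%C.
      field; auto. replace (- / lam * n1)%C with (- / lam * n1 - t + t)%C by ring. rewrite E; ring. }
    assert (E4 : 1 <= Cmod (n1 - 1) + Cmod (n2 - 1)).
    { apply Rle_trans with (Cmod (- (n1 - 1) + - (n2 - 1))%C).
      rewrite <- E3, Cmod_1; lra. eapply Rle_trans. apply Cmod_triangle.
      rewrite !Cmod_opp. lra. }
    assert (E5 : d * m < 1).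
    { apply Rmult_lt_reg_r with (/ m). now apply Rinv_0_lt_compat.
      rewrite Rmult_assoc, Rinv_r; lra. }
    replace (d * m) with (2 * d / (1 - Cmod (ratio_plus r lam)) + 2 * d / (1 - Cmod (ratio_minus r lam))) in E5
      by (unfold m; field; lra).
    lra.
Qed.

Lemma Csqrt_exists (z : C) : exists w : C, (w * w = z)%C.
Proof.
  destruct z as [x y]. set (m := sqrt (x ^ 2 + y ^ 2)).
  assert (Hm : m * m = x ^ 2 + y ^ 2) by (apply sqrt_sqrt; nra).
  assert (Hm0 : 0 <= m) by apply sqrt_pos.
  assert (Hx : - m <= x <= m) by (split; nra).
  set (u := sqrt ((m + x) / 2)). set (v := sqrt ((m - x) / 2)).
  assert (Hu : u * u = (m + x) / 2) by (apply sqrt_sqrt; lra).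
  assert (Hv : v * v = (m - x) / 2) by (apply sqrt_sqrt; lra).
  assert (Huv : u * v = Rabs y / 2).
  { unfold u, v. rewrite <- sqrt_mult by lra.
    replace ((m + x) / 2 * ((m - x) / 2)) with (Rsqr (y / 2)).
    rewrite sqrt_Rsqr_abs. unfold Rdiv. rewrite Rabs_mult, (Rabs_pos_eq (/ 2)); lra.
    unfold Rsqr. replace ((m + x) / 2 * ((m - x) / 2)) with ((m * m - x * x) / 4) by field.
    rewrite Hm. field. }
  destruct (Rle_lt_dec 0 y).
  - exists (u, v). rewrite Rabs_pos_eq in Huv by auto.
    apply injective_projections; simpl; lra.
  - exists (u, - v). rewrite Rabs_left in Huv by auto.
    apply injective_projections; simpl; lra.
Qed.

Definition linear_form (L : seqC -> C) : Prop := forall c f g, l2 f -> l2 g ->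
  L (addS (scalS c f) g) = (c * L f + L g)%C.

Lemma linear_form_zero L : linear_form L -> L zeroS = RtoC 0.
Proof.
  intros F. assert (E := F 1 zeroS zeroS l2_zero l2_zero).
  replace (addS (scalS 1 zeroS) zeroS) with zeroS in E.
  2:{ apply seq_ext; intros; unfold addS, scalS, zeroS; ring. }
  replace (L zeroS) with (1 * L zeroS + L zeroS - L zeroS)%C by ring.
  rewrite <- E. ring.
Qed.

Lemma linear_form_scal L c f : linear_form L -> l2 f -> L (scalS c f) = (c * L f)%C.
Proof.
  intros F Hf. assert (E := F c f zeroS Hf l2_zero).
  rewrite linear_form_zero, Cplus_0_r in E by auto. rewrite <- E.
  f_equal. apply seq_ext; intros; unfold addS, zeroS; ring.
Qed.

(* Write [phi_r = phi_p o phi_p] and [lam = z^2].  The eigenspaces of the operator of [p] for [z] and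
   [- z] are independent and both lie in the kernel for [r], so combining one vector of each
   gains one linear condition. *)
Lemma kernel_rich (Ls : list (seqC -> C)) : (forall L, In L Ls -> linear_form L) ->
  forall r lam, 0 < r < 1 -> kap r < Cmod lam < / kap r ->
  exists g, l2 g /\ comp (- r) g = scalS lam g /\ g <> zeroS /\ forall L, In L Ls -> L g = RtoC 0.
Proof.
  induction Ls as [|L Ls IH]; intros HL r lam Hr Hlam.
  - destruct (kernel_nonzero r lam) as (g & G1 & G2 & G3); auto; try lra.
    rewrite Rabs_pos_eq; lra. exists g. repeat split; auto. intros L [].
  - assert (IH' := IH (fun L' H => HL L' (or_intror H))). clear IH.
    (* [p = r / (1 + t)] is the smaller root of [2 p = r (1 + p^2)], which is the condition for
       [phi_p o phi_p = phi_r]. *)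
    set (t := sqrt (1 - r ^ 2)).
    assert (Ht : t * t = 1 - r ^ 2) by (apply sqrt_sqrt; nra).
    assert (Ht0 : 0 <= t) by apply sqrt_pos.
    assert (Ht1 : t < 1) by nra.
    set (p := r / (1 + t)).
    assert (Hp0 : 0 < p) by (apply Rdiv_lt_0_compat; lra).
    assert (Hpt : p * (1 + t) = r) by (unfold p; field; lra).
    assert (Hp1 : p < 1) by nra.
    assert (Hpr : 2 * p = r * (1 + p ^ 2)).
    { apply Rmult_eq_reg_r with ((1 + t) ^ 2); [|nra].
      replace (r * (1 + p ^ 2) * (1 + t) ^ 2) with (r * ((1 + t) ^ 2 + (p * (1 + t)) ^ 2)) by ring.
      rewrite Hpt. replace (2 * p * (1 + t) ^ 2) with (2 * (p * (1 + t)) * (1 + t)) by ring.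
      rewrite Hpt. replace ((1 + t) ^ 2) with (1 + 2 * t + t * t) by ring. rewrite Ht. ring. }
    assert (Ar : Rabs r < 1) by (rewrite Rabs_pos_eq; lra).
    assert (Ap : Rabs p < 1) by (rewrite Rabs_pos_eq; lra).
    assert (Ar' : Rabs (- r) < 1) by now rewrite Rabs_Ropp.
    assert (Ap' : Rabs (- p) < 1) by now rewrite Rabs_Ropp.
    assert (Kr := kap_pos r Ar). assert (Kp := kap_pos p Ap).
    (* By this relation the annulus for [r] is the image of the annulus for [p] under squaring, so
       both square roots of [lam] are admissible for [p]. *)
    assert (Hk : kap p * kap p = kap r).
    { apply Rsqr_inj; try nra. unfold Rsqr. rewrite kap_sqr, kap_sqr by auto.
      replace r with (2 * p / (1 + p ^ 2)) by (apply Rmult_eq_reg_r with (1 + p ^ 2); [|nra];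
       rewrite <- Hpr; field; nra). field. repeat split; nra. }
    assert (HK2 : forall g, l2 g -> comp (- p) (comp (- p) g) = comp (- r) g).
    { intros g Hg. apply comp_comp; auto. intros x Hx.
      assert (D1 := mobius_den (-p) x Ap' Hx).
      assert (D2 := mobius_den (-p) _ Ap' (mobius_lt (-p) x Ap' Hx)).
      assert (D3 := mobius_den (-r) x Ar' Hx).
      unfold mobius in *.
      assert (D4 : 0 < (1 + - p * x) + - p * (x + - p)).
      { replace (1 + - p * x + - p * (x + - p)) with
         ((1 + - p * ((x + - p) / (1 + - p * x))) * (1 + - p * x)) by (field; lra).
        now apply Rmult_lt_0_compat. }
      replace r with (2 * p / (1 + p ^ 2)) by (apply Rmult_eq_reg_r with (1 + p ^ 2); [|nra];
       rewrite <- Hpr; field; nra).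
      field. repeat split; nra. }
    destruct (Csqrt_exists lam) as [z Hz].
    assert (Hzm : Cmod z * Cmod z = Cmod lam) by (rewrite <- Hz, Cmod_mult; ring).
    assert (Z0 := Cmod_ge_0 z).
    assert (Hzk : kap p < Cmod z < / kap p).
    { split. nra. apply Rnot_le_lt. intros Hc.
      assert (Hi : 0 < / kap p) by now apply Rinv_0_lt_compat.
      assert (E : / kap r = / kap p * / kap p) by (rewrite <- Hk; field; lra).
      rewrite E in Hlam. nra. }
    destruct (IH' p z) as (g1 & A1 & B1 & C1 & D1); auto.
    destruct (IH' p (- z)%C) as (g2 & A2 & B2 & C2 & D2); auto. now rewrite Cmod_opp.
    assert (Klin := comp_linear p Ap).
    assert (G1 : comp (- r) g1 = scalS lam g1).
    { rewrite <- HK2, B1, (proj2 Klin), B1; auto.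
      apply seq_ext; intros; unfold scalS; rewrite <- Hz; ring. }
    assert (G2 : comp (- r) g2 = scalS lam g2).
    { rewrite <- HK2, B2, (proj2 Klin), B2; auto.
      apply seq_ext; intros; unfold scalS; rewrite <- Hz; ring. }
    assert (Lfun := HL L (or_introl eq_refl)).
    destruct (excluded_middle_informative (L g1 = RtoC 0)) as [H0|H0].
    + exists g1. repeat split; auto. intros L' [<-|H]; auto.
    (* The coefficients are chosen so that [L] vanishes on the combination. *)
    + exists (addS (scalS (- L g2) g1) (scalS (L g1) g2)).
      split; [apply l2_add; now apply l2_scal|]. split; [|split].
      * rewrite (proj1 (comp_linear r Ar)), !(proj2 (comp_linear r Ar)), G1, G2; auto using l2_scal.
        apply seq_ext; intros; unfold addS, scalS; ring.
      * intros E. apply C2.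
        (* The operator of [p] acts by [z] on [g1] and by [- z] on [g2]. Eliminating [g1] between
           [E] and [E'] leaves [2 z (L g1) g2 = 0], against [g2 <> 0]. *)
        assert (E' := f_equal (comp (- p)) E).
        rewrite (proj1 Klin), !(proj2 Klin), B1, B2, linear_zero in E'; auto using l2_scal.
        apply seq_ext; intros n.
        apply (f_equal (fun f => f n)) in E. apply (f_equal (fun f => f n)) in E'.
        unfold addS, scalS, zeroS in *.
        assert (z <> 0). { intros Ez. rewrite Ez, Cmod_0 in Hzk. lra. }
        assert (R : (2 * (z * L g1) * g2 n = 0)%C).
        { replace (2 * (z * L g1) * g2 n)%C with
           (z * (- L g2 * g1 n + L g1 * g2 n) - (- L g2 * (z * g1 n) + L g1 * (- z * g2 n)))%C by ring.
          rewrite E, E'. ring. }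
        replace (g2 n) with (/ (2 * (z * L g1)) * (2 * (z * L g1) * g2 n))%C.
        rewrite R; ring.
        field. auto.
      * intros L' [<-|H].
        rewrite Lfun, linear_form_scal; auto using l2_scal. ring.
        assert (F := HL L' (or_intror H)).
        rewrite F, linear_form_scal, (D1 L'), (D2 L'); auto using l2_scal. ring.
Qed.

(** * Orthonormal kernel vectors and universality on H^2 *)

Definition inner (g h : seqC) : C :=
  (Series (fun n => fst (g n * Cconj (h n))%C), Series (fun n => snd (g n * Cconj (h n))%C)).

Definition normsq (g : seqC) : R := Series (fun n => Cmod (g n) ^ 2).

Lemma normle_normsq g : l2 g -> normle g (sqrt (normsq g)).
Proof. apply normle_Series. Qed.

Lemma normsq_le g B : normle g B -> normsq g <= B ^ 2.
Proof.
  intros H.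
  assert (Hs : is_lim_seq (sum_n (fun n => Cmod (g n) ^ 2)) (normsq g))
    by exact (Series_correct _ (l2_ex_series g (ex_intro _ B H))).
  exact (is_lim_seq_le _ (fun _ => B ^ 2) (normsq g) (B ^ 2) (proj2 H) Hs (is_lim_seq_const _)).
Qed.

Lemma normsq_pos g : l2 g -> 0 <= normsq g.
Proof.
  intros H. eapply Rle_trans.
  2: apply (sum_le_Series (fun n => Cmod (g n) ^ 2) O);
     [intros; apply pow2_ge_0|now apply l2_ex_series].
  rewrite sum_n_0. apply pow2_ge_0.
Qed.

Lemma normle_of_normsq g B : l2 g -> 0 <= B -> normsq g <= B ^ 2 -> normle g B.
Proof.
  intros Hg HB H. apply normle_mono with (sqrt (normsq g)). now apply normle_normsq.
  rewrite <- (sqrt_pow2 B HB). now apply sqrt_le_1_alt.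
Qed.

Lemma sqrt_normsq_le g B : normle g B -> sqrt (normsq g) <= B.
Proof.
  intros H. rewrite <- (sqrt_pow2 B (proj1 H)). apply sqrt_le_1_alt. now apply normsq_le.
Qed.

Lemma inner_ex g h : l2 g -> l2 h ->
  ex_series (fun n => fst (g n * Cconj (h n))%C) /\ ex_series (fun n => snd (g n * Cconj (h n))%C).
Proof.
  intros Hg Hh.
  assert (E : ex_series (fun n => Cmod (g n) ^ 2 + Cmod (h n) ^ 2)).
  { apply (ex_series_plus (fun n => Cmod (g n) ^ 2) (fun n => Cmod (h n) ^ 2));
    now apply l2_ex_series. }
  assert (L : forall n, Cmod (g n * Cconj (h n))%C <= Cmod (g n) ^ 2 + Cmod (h n) ^ 2).
  { intros n. rewrite Cmod_mult, Cmod_conj. 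
    assert (P := Cmod_ge_0 (g n)). assert (Q := Cmod_ge_0 (h n)). nra. }
  split; eapply (ex_series_le (K := R_AbsRing) (V := R_CompleteNormedModule)); try apply E;
  intros n; eapply Rle_trans; try apply L; [apply Cmod_fst_le|apply Cmod_snd_le].
Qed.

Lemma inner_linear_form h : l2 h -> linear_form (fun g => inner g h).
Proof.
  intros Hh c f g Hf Hg. destruct (inner_ex f h Hf Hh) as [F1 F2], (inner_ex g h Hg Hh) as [G1 G2].
  assert (S : forall (x : R) u, ex_series u -> ex_series (fun n => x * u n)).
  { intros x u Hu. exact (ex_series_scal_l x u Hu). }
  unfold inner. apply injective_projections; simpl fst; simpl snd.
  - rewrite <- !Series_scal_l, <- Series_minus, <- Series_plus; auto.
    + apply Series_ext; intros n. unfold addS, scalS. simpl; ring.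
    + apply (ex_series_minus (fun n => fst c * fst (f n * Cconj (h n))%C)
        (fun n => snd c * snd (f n * Cconj (h n))%C)); auto.
  - rewrite <- !Series_scal_l, <- Series_plus, <- Series_plus; auto.
    + apply Series_ext; intros n. unfold addS, scalS. simpl; ring.
    + apply (ex_series_plus (fun n => fst c * snd (f n * Cconj (h n))%C)
        (fun n => snd c * fst (f n * Cconj (h n))%C)); auto.
Qed.

Lemma inner_sym_0 g h : inner g h = RtoC 0 -> inner h g = RtoC 0.
Proof.
  unfold inner. intros E. injection E as E1 E2. apply injective_projections; simpl fst; simpl snd.
  - rewrite <- E1. apply Series_ext; intros n; simpl; ring.
  - rewrite <- Ropp_0, <- E2, <- Series_opp. apply Series_ext; intros n; simpl; ring.
Qed.

Lemma pythagoras g q c : l2 g -> l2 q -> inner g q = RtoC 0 ->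
  normsq (addS g (scalS c q)) = normsq g + Cmod c ^ 2 * normsq q.
Proof.
  intros Hg Hq H. destruct (inner_ex g q Hg Hq) as [F1 F2].
  assert (H1 := f_equal fst H). assert (H2 := f_equal snd H). unfold inner, RtoC in H1, H2.
  change (Series (fun n => fst (g n * Cconj (q n))%C) = 0) in H1.
  change (Series (fun n => snd (g n * Cconj (q n))%C) = 0) in H2. unfold normsq.
  assert (S : forall (x : R) u, ex_series u -> ex_series (fun n => x * u n)).
  { intros x u Hu. exact (ex_series_scal_l x u Hu). }
  assert (P : forall u v : nat -> R, ex_series u -> ex_series v -> ex_series (fun n => u n + v n)).
  { intros u v Hu Hv. exact (ex_series_plus u v Hu Hv). }
  assert (A := l2_ex_series g Hg). assert (B := l2_ex_series q Hq).
  transitivity (Series (fun n => Cmod (g n) ^ 2 + Cmod c ^ 2 * Cmod (q n) ^ 2 +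
     ((2 * fst c) * fst (g n * Cconj (q n))%C + (2 * snd c) * snd (g n * Cconj (q n))%C))).
  - apply Series_ext; intros n. rewrite !Cmod_sqr. unfold addS, scalS. simpl; ring.
  - rewrite (Series_plus (fun n => Cmod (g n) ^ 2 + Cmod c ^ 2 * Cmod (q n) ^ 2)), !Series_plus;
      auto.
    rewrite !Series_scal_l. rewrite H1, H2. ring.
Qed.

Lemma coord_linear_form n : linear_form (fun g => g n).
Proof. intros c f g _ _. reflexivity. Qed.

(** The condition at index 0 makes these vectors insensitive to the passage modulo constants. *)
Definition in_kernel (r : R) (lam : C) (g : seqC) : Prop :=
  l2 g /\ comp (- r) g = scalS lam g /\ g O = RtoC 0.

(** The condition on [l] stands under the existential so that choice yields a function on all lists.
    Evaluation at 0 is added to the functionals to be annihilated. *)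
Lemma kernel_unit_orth r lam : 0 < r < 1 -> kap r < Cmod lam < / kap r ->
  forall l : list seqC, exists q, (forall v, In v l -> l2 v) ->
  in_kernel r lam q /\ normsq q = 1 /\ forall v, In v l -> inner q v = RtoC 0.
Proof.
  intros Hr Hlam l.
  destruct (excluded_middle_informative (forall v, In v l -> l2 v)) as [Hl|Hl].
  2:{ exists zeroS. now intros. }
  destruct (kernel_rich ((fun g => g O) :: map (fun v g => inner g v) l)) with (r := r) (lam := lam)
    as (g & G1 & G2 & G3 & G4); auto.
  { intros L [<-|H]. apply coord_linear_form. apply in_map_iff in H as (v & <- & Hv).
    apply inner_linear_form; auto. }
  assert (Ar : Rabs r < 1) by (rewrite Rabs_pos_eq; lra).
  assert (N0 := normsq_pos g G1).
  assert (Npos : 0 < normsq g).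
  { destruct N0 as [N0|N0]; auto. exfalso. apply G3. apply normle_0_eq.
    apply normle_of_normsq; auto; lra. }
  assert (Sp : 0 < sqrt (normsq g)) by now apply sqrt_lt_R0.
  exists (scalS (RtoC (/ sqrt (normsq g))) g). intros _. split; [split; [|split]|split].
  - now apply l2_scal.
  - rewrite (proj2 (comp_linear r Ar)), G2 by auto.
    apply seq_ext; intros; unfold scalS; ring.
  - unfold scalS. rewrite (G4 (fun g => g O)) by now left. ring.
  - unfold normsq at 1. unfold scalS.
    rewrite (Series_ext _ (fun n => (/ sqrt (normsq g)) ^ 2 * Cmod (g n) ^ 2)).
    2:{ intros n. rewrite Cmod_mult, Cmod_R, Rabs_pos_eq.
        ring. left; now apply Rinv_0_lt_compat. }
    rewrite Series_scal_l. fold (normsq g).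
    replace ((/ sqrt (normsq g)) ^ 2) with (/ (sqrt (normsq g) * sqrt (normsq g))) by (field; lra).
    rewrite sqrt_sqrt by auto. field; lra.
  - intros v Hv. assert (F := inner_linear_form v (Hl v Hv)). rewrite (linear_form_scal _ _ _ F G1).
    rewrite (G4 (fun g => inner g v)). ring. right. apply in_map_iff. now exists v.
Qed.

(** Orthogonality is imposed at the time of choice: each vector is picked from the kernel subject to
    the finitely many conditions set by the earlier ones, so no Gram-Schmidt process is needed. *)
Lemma kernel_orthonormal r lam : 0 < r < 1 -> kap r < Cmod lam < / kap r ->
  exists q : nat -> seqC, (forall n, in_kernel r lam (q n)) /\ (forall n, normsq (q n) = 1) /\
  forall i n, (i < n)%nat -> inner (q i) (q n) = RtoC 0.
Proof.
  intros Hr Hlam.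
  set (F := fun l => proj1_sig (constructive_indefinite_description _
    (kernel_unit_orth r lam Hr Hlam l))).
  assert (HF : forall l, (forall v, In v l -> l2 v) ->
    in_kernel r lam (F l) /\ normsq (F l) = 1 /\ forall v, In v l -> inner (F l) v = RtoC 0).
  { intros l. exact (proj2_sig (constructive_indefinite_description _
    (kernel_unit_orth r lam Hr Hlam l))). }
  set (gs := fun n => Nat.iter n (fun l => F l :: l) nil).
  assert (Hgs : forall n v, In v (gs n) -> l2 v).
  { induction n; simpl. tauto. intros v [<-|H]; auto. apply (HF (gs n)); auto. }
  exists (fun n => F (gs n)). split; [|split].
  - intros n. apply HF. apply Hgs.
  - intros n. apply HF. apply Hgs.
  - intros i n Hin. apply inner_sym_0. apply (HF (gs n)). apply Hgs.
    induction Hin; simpl; auto.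
Qed.

Section Orthonormal.
Variable q : nat -> seqC.
Hypothesis Hl2 : forall n, l2 (q n).
Hypothesis Hone : forall n, normsq (q n) = 1.
Hypothesis Horth : forall i n, (i < n)%nat -> inner (q i) (q n) = RtoC 0.

Lemma inner_fpart f n N : (N <= n)%nat -> inner (fpart q f N) (q n) = RtoC 0.
Proof.
  intros HN. assert (F := inner_linear_form (q n) (Hl2 n)). induction N.
  - apply (linear_form_zero _ F).
  - unfold fpart in *; simpl.
    replace (addS (vpart (fun k => scalS (f k) (q k)) N) (scalS (f N) (q N))) with
     (addS (scalS (f N) (q N)) (vpart (fun k => scalS (f k) (q k)) N))
     by (apply seq_ext; intros; unfold addS; ring).
    rewrite F, IHN, Horth; auto; try lia. ring. now apply (l2_fpart q f N).
Qed.

Lemma partial_normsq_S_r f N : partial_normsq f (S N) = partial_normsq f N + Cmod (f N) ^ 2.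
Proof. destruct N; simpl. rewrite sum_n_0. simpl; lra. now rewrite sum_n_S. Qed.

Lemma normsq_fpart f N : normsq (fpart q f N) = partial_normsq f N.
Proof.
  induction N.
  - unfold fpart; simpl. unfold normsq, zeroS.
    apply Rle_antisym. apply Rle_trans with (0 ^ 2). apply normsq_le, normle_zero. simpl; lra.
    apply (normsq_pos zeroS l2_zero).
  - rewrite partial_normsq_S_r, <- IHN. unfold fpart at 1; simpl vpart. fold (fpart q f N).
    rewrite pythagoras, Hone; auto. ring. now apply l2_fpart. now apply inner_fpart.
Qed.

Lemma orthonormal_bessel : bessel q.
Proof.
  intros f B N [HB H]. apply normle_of_normsq; auto. now apply l2_fpart.
  rewrite normsq_fpart. destruct N; [apply pow2_ge_0|apply H].
Qed.

(** With the Bessel bound this makes [synthesis q] isometric. The norm of a finite sum is exact by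
    Pythagoras, and the limit costs an arbitrarily small [e]. *)
Lemma synthesis_lower f B : l2 f -> normle (synthesis q f) B -> normle f B.
Proof.
  intros Hf H. assert (HB := proj1 H). apply normle_eps; auto. intros e He.
  split; [lra|]. intros N.
  destruct (synthesis_conv q f orthonormal_bessel Hf e He) as [M HM].
  (* Late enough for the approximation, and long enough to contain the indices 0 to [N]. *)
  specialize (HM (max M (S N)) ltac:(lia)). set (m := max M (S N)) in *.
  assert (G : normle (fpart q f m) (B + e)).
  { replace (fpart q f m) with (addS (synthesis q f) (subS (fpart q f m) (synthesis q f))).
    now apply normle_add. apply seq_ext; intros; unfold addS, subS; ring. }
  apply normsq_le in G. rewrite normsq_fpart in G.
  eapply Rle_trans; [|apply G].
  assert (Mono : forall d, partial_normsq f (S N) <= partial_normsq f (S N + d)).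
  { induction d. rewrite Nat.add_0_r; lra. rewrite Nat.add_succ_r, (partial_normsq_S_r f (S N + d)).
    assert (P := pow2_ge_0 (Cmod (f (S N + d)%nat))). lra. }
  replace m with (S N + (m - S N))%nat by lia. apply (Mono (m - S N)%nat).
Qed.
End Orthonormal.

(** * The Caradus construction *)

Definition drop0 (g : seqC) : seqC := fun n => match n with O => RtoC 0 | _ => g n end.

Lemma drop0_normle g B : normle g B -> normle (drop0 g) B.
Proof.
  intros [HB H]. split; auto. intros N. eapply Rle_trans; [|apply (H N)].
  induction N.
  - rewrite !sum_n_0. unfold drop0. rewrite Cmod_0. assert (P := pow2_ge_0 (Cmod (g O))).
    rewrite pow_i by lia. exact P.
  - rewrite !sum_n_S. simpl drop0. lra.
Qed.

(** The lower bound is stated after [drop0], because only the class of [X f] modulo constants is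
    seen by [S^2]. *)
Lemma hardy_model r lam T KT : 0 < r < 1 -> kap r < Cmod lam < / kap r -> bounded_l2 T KT ->
  exists (c : C) (X : op) (K : R), c <> RtoC 0 /\ bounded_l2 X K /\
  (forall f, l2 f -> subS (comp (- r) (X f)) (scalS lam (X f)) = scalS c (X (T f))) /\
  (forall f B, l2 f -> normle (drop0 (X f)) B -> normle f (2 * B)).
Proof.
  intros Hr Hlam HT. assert (Ar : Rabs r < 1) by (rewrite Rabs_pos_eq; lra).
  destruct (kernel_orthonormal r lam Hr Hlam) as (q & Q1 & Q2 & Q3).
  assert (Ql : forall n, l2 (q n)) by (intros; apply Q1).
  assert (Qb := orthonormal_bessel q Ql Q2 Q3).
  destruct (right_inv_bounded r lam Ar Hlam) as [KV HV].
  set (V := right_inv r lam) in *.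
  assert (HVK : 0 <= KV) by apply HV. assert (HTK : 0 <= KT) by apply HT.
  (* Makes the ratio [p = KV * c * KT] at most 1/3, so the terms of [X] beyond the first have total
     norm at most [p / (1 - p) <= 1/2] times that of [f]. The summand 1 avoids a division by
     zero. *)
  set (c := / (3 * (KV * KT + 1))).
  assert (Pc : 0 < c) by (apply Rinv_0_lt_compat; nra).
  set (p := KV * (c * KT)).
  assert (Hp : 0 <= p <= / 3).
  { split. apply Rmult_le_pos; nra.
    unfold p, c. apply Rmult_le_reg_r with (3 * (KV * KT + 1)); [nra|].
    replace (KV * (/ (3 * (KV * KT + 1)) * KT) * (3 * (KV * KT + 1))) with (KV * KT)
     by (field; nra). nra. }
  assert (HcT : bounded_l2 (scaled (RtoC c) T) (c * KT)).
  { apply bounded_ext with (Cmod c * KT). now apply bounded_scal.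
    rewrite Cmod_R, Rabs_pos_eq; lra. }
  set (Sq := synthesis q).
  assert (HS : bounded_l2 Sq 1) by now apply synthesis_bounded.
  set (F := fun k f => Nat.iter k V (Sq (Nat.iter k (scaled (RtoC c) T) f))).
  assert (HF : forall k, bounded_l2 (F k) (1 * p ^ k)).
  { intros k. apply bounded_ext with (KV ^ k * (1 * (c * KT) ^ k)).
    - apply (bounded_comp (fun g => Nat.iter k V g)
        (fun f => Sq (Nat.iter k (scaled (RtoC c) T) f))).
      now apply bounded_iter. apply (bounded_comp Sq). auto. now apply bounded_iter.
    - unfold p. rewrite !Rpow_mult_distr. ring. }
  set (X := fun f => vsum (fun k => F k f)).
  assert (HX : bounded_l2 X (1 / (1 - p))) by (apply vsum_linear; auto; lra).
  assert (HXc : forall f, l2 f -> conv (vpart (fun k => F k f)) (X f)).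
  { intros f [B Hf]. apply (vsum_geom (fun k => F k f) B p); [lra|].
    intros k. replace (B * p ^ k) with (1 * p ^ k * B) by ring. now apply HF. }
  assert (HFl : forall k f, l2 f -> l2 (F k f)) by (intros k f; apply (bounded_maps_l2 _ _ _ (HF k))).
  destruct (comp_bounded (- r)) as [KC HC]. now rewrite Rabs_Ropp.
  set (U := fun g => addS (comp (- r) g) (scalS (- lam)%C g)).
  assert (HU : exists KU, bounded_l2 U KU).
  { eexists. apply bounded_add. apply HC. apply (bounded_scal (- lam)%C (fun g => g)), bounded_id. }
  destruct HU as [KU HU].
  assert (US : forall f, l2 f -> U (Sq f) = zeroS).
  { intros f Hf. apply conv_unique with (fun N => U (fpart q f N)).
    - apply conv_bounded with KU; auto. intros; now apply l2_fpart. now apply synthesis_conv.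
    - apply conv_ext with (fun _ => zeroS); [|apply conv_const]. intros N.
      unfold fpart. rewrite vpart_linear; [|apply HU|intros; now apply l2_scal].
      induction N; simpl; auto. rewrite <- IHN. rewrite (proj2 (proj1 HU)) by auto.
      unfold U. rewrite (proj1 (proj2 (Q1 N))).
      apply seq_ext; intros; unfold addS, scalS, zeroS; ring. }
  assert (UV : forall g, l2 g -> U (V g) = g).
  { intros g Hg. transitivity (subS (comp (- r) (V g)) (scalS lam (V g))).
    2: exact (right_inv_spec r lam Ar Hlam g Hg).
    apply seq_ext; intros; unfold U, addS, scalS, subS; fold V; ring. }
  exists (RtoC c), X, (1 / (1 - p)). split; [|split; [|split]].
  - apply RtoC_neq_0; lra.
  - auto.
  - intros f Hf. assert (HTf : l2 (T f)) by now apply (bounded_maps_l2 T KT).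
    transitivity (U (X f)). apply seq_ext; intros; unfold U, addS, scalS, subS; ring.
    transitivity (X (scalS (RtoC c) (T f))). 2: now apply HX.
    (* [U] kills the first term and removes one [V] from each other term, so it sends the partial
       sum of length [S N] at [f] to the one of length [N] at [c T f]. *)
    apply conv_unique with (fun N => U (vpart (fun k => F k f) (S N))).
    + apply (conv_shift (fun N => U (vpart (fun k => F k f) N))).
      apply conv_bounded with KU; auto. intros; apply l2_vpart; auto.
    + eapply conv_ext; [|apply HXc; now apply l2_scal]. intros N. simpl.
      change (addS (vpart (fun k => F k f) N) (F N f)) with (vpart (fun k => F k f) (S N)).
      rewrite vpart_linear; auto; [|apply HU]. rewrite vpart_S.
      change (F O f) with (Sq f). rewrite US by auto.
      transitivity (vpart (fun k => U (F (S k) f)) N).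
      * apply vpart_ext. intros k.
        replace (F (S k) f) with (V (F k (scalS (RtoC c) (T f)))).
        symmetry. apply UV, HFl. now apply l2_scal.
        unfold F. now rewrite (Nat.iter_succ_r k _ (scaled (RtoC c) T)).
      * apply seq_ext; intros; unfold addS, zeroS; ring.
  - intros f B Hf HB.
    assert (HN := normle_normsq f Hf). set (N := sqrt (normsq f)) in *.
    assert (Hrest : conv (vpart (fun k => F (S k) f)) (vsum (fun k => F (S k) f)) /\
      normle (vsum (fun k => F (S k) f)) (N * p / (1 - p))).
    { apply vsum_geom; [lra|]. intros k.
      replace (N * p * p ^ k) with (1 * p ^ (S k) * N) by (simpl; ring). now apply HF. }
    destruct Hrest as [Rc Rn]. set (Y := vsum (fun k => F (S k) f)) in *.
    assert (EX : X f = addS (Sq f) Y).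
    { apply conv_unique with (fun N => vpart (fun k => F k f) (S N)).
      - apply conv_shift. now apply HXc.
      - eapply conv_ext; [|apply conv_add; [apply conv_const|apply Rc]].
        intros n. rewrite vpart_S. reflexivity. }
    (* Hence [Sq f] equals [drop0 (X f) - drop0 Y]. As [Sq] is isometric, [N <= B + N / 2], which
       gives the factor 2. *)
    assert (S0 : Sq f O = RtoC 0).
    { apply Clim_unique with (fun N => fpart q f N O).
      - apply conv_coord. now apply synthesis_conv.
      - apply Clim_ext with (fun _ => RtoC 0).
        + intros n; induction n; unfold fpart in *; simpl; auto.
          unfold addS. rewrite <- IHn. unfold scalS. rewrite (proj2 (proj2 (Q1 n))). ring.
        + intros e He. exists O. intros. replace (0 - 0)%C with (RtoC 0) by ring.
          rewrite Cmod_0; lra. }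
    assert (N0 := proj1 HN).
    assert (HSf : normle (Sq f) (B + N / 2)).
    { replace (Sq f) with (subS (drop0 (X f)) (drop0 Y)).
      - apply normle_sub; auto. apply drop0_normle. apply normle_mono with (N * p / (1 - p)); auto.
        apply Rmult_le_reg_r with (1 - p); [lra|].
        unfold Rdiv at 1. rewrite Rmult_assoc, Rinv_l by lra. nra.
      - apply seq_ext; intros [|n]; unfold subS; simpl. rewrite S0; ring.
        rewrite EX. unfold addS; ring. }
    apply synthesis_lower in HSf; auto.
    apply sqrt_normsq_le in HSf. fold N in HSf.
    apply normle_mono with N; auto. lra.
Qed.

(** * From H^2 to S^2 *)

Lemma is_series_C_components (u : nat -> C) (v : C) :
  @is_series C_AbsRing C_NormedModule u v ->
  is_series (fun n => fst (u n)) (fst v) /\ is_series (fun n => snd (u n)) (snd v).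
Proof.
  intros H.
  assert (E : forall n, sum_n (fun n => fst (u n)) n = fst (sum_n (G := C_NormedModule) u n) /\
                        sum_n (fun n => snd (u n)) n = snd (sum_n (G := C_NormedModule) u n)).
  { induction n as [|n [I1 I2]]. rewrite !sum_O; auto. rewrite !sum_Sn, I1, I2; auto. }
  unfold is_series in *. split.
  - apply filterlim_ext with (fun n => fst (sum_n (G := C_NormedModule) u n)).
    intros x; symmetry; apply (proj1 (E x)).
    apply filterlim_locally. intros e.
    assert (H' := proj1 (@filterlim_locally nat C_UniformSpace eventually _ (sum_n (G := C_NormedModule) u) v) H e).
    clear H; rename H' into H.
    revert H. apply filter_imp. intros n [H _]. exact H.
  - apply filterlim_ext with (fun n => snd (sum_n (G := C_NormedModule) u n)).
    intros x; symmetry; apply (proj2 (E x)).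
    apply filterlim_locally. intros e.
    assert (H' := proj1 (@filterlim_locally nat C_UniformSpace eventually _ (sum_n (G := C_NormedModule) u) v) H e).
    clear H; rename H' into H.
    revert H. apply filter_imp. intros n [_ H]. exact H.
Qed.

Lemma is_series_delta n (v : nat -> C) :
  @is_series C_AbsRing C_NormedModule (fun k => (delta n k * v k)%C) (v n).
Proof.
  assert (E0 : forall N, (N < n)%nat ->
    sum_n (G := C_NormedModule) (fun k => (delta n k * v k)%C) N = RtoC 0).
  { induction N as [|N IH]; intros HN; rewrite ?sum_O, ?sum_Sn, ?IH by lia; unfold delta.
    - destruct (Nat.eqb_spec 0 n); [lia|]. change (RtoC 0 * v O = RtoC 0)%C. ring.
    - destruct (Nat.eqb_spec (S N) n); [lia|].
      change (RtoC 0 + RtoC 0 * v (S N) = RtoC 0)%C. ring. }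
  assert (E1 : forall N, sum_n (G := C_NormedModule) (fun k => (delta n k * v k)%C) (n + N) = v n).
  { induction N as [|N IH].
    - rewrite Nat.add_0_r. destruct n as [|n].
      + rewrite sum_O. change (RtoC 1 * v O = v O)%C. ring.
      + rewrite sum_Sn, E0 by lia. unfold delta. rewrite Nat.eqb_refl.
        change (RtoC 0 + RtoC 1 * v (S n) = v (S n))%C. ring.
    - rewrite Nat.add_succ_r, sum_Sn, IH. unfold delta.
      destruct (Nat.eqb_spec (S (n + N)) n); [lia|].
      change (v n + RtoC 0 * v (S (n + N))%nat = v n)%C. ring. }
  unfold is_series. apply filterlim_ext_loc with (fun _ => v n).
  - exists n. intros N HN. replace N with (n + (N - n))%nat by lia. symmetry; apply E1.
  - apply filterlim_const.
Qed.

(** * The matrix of the composition operator and its duality *)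

(** The Taylor coefficients of [phi_a^n], that is, column [n] of the matrix of composition with
    [phi_a] in the monomials. *)
Definition mobius_pow (a : R) (n : nat) : seqC := Nat.iter n (mul_mobius a) (delta 0).

Lemma mobius_pow_l2 a n : Rabs a < 1 -> l2 (mobius_pow a n).
Proof.
  intros Ha; exists 1; induction n; simpl. apply normle_delta. now apply mul_mobius_normle.
Qed.

Lemma eval_mobius_pow a n x : Rabs a < 1 -> Rabs x < 1 -> eval x (mobius_pow a n) = RtoC (mobius a x ^ n).
Proof.
  intros Ha Hx. induction n.
  - apply (eval_delta x 0 Hx).
  - change (mobius_pow a (S n)) with (mul_mobius a (mobius_pow a n)).
    rewrite eval_mul_mobius, IHn, <- RtoC_mult; auto. now apply mobius_pow_l2.
Qed.

Lemma real_mobius_pow a n m : Cconj (mobius_pow a n m) = mobius_pow a n m.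
Proof.
  revert m. induction n; intros m.
  - unfold mobius_pow, delta; simpl. destruct (Nat.eqb m 0); apply injective_projections; simpl; ring.
  - change (mobius_pow a (S n)) with (mul_mobius a (mobius_pow a n)).
    set (f := mobius_pow a n) in *.
    assert (I : forall m, Cconj (div_lin a f m) = div_lin a f m).
    { induction m0; simpl; auto. unfold Cminus.
      rewrite Cplus_conj, Copp_conj, Cmult_conj, IHm0, IHn. f_equal. f_equal.
      apply injective_projections; simpl; ring. }
    unfold mul_mobius, addS, scalS. rewrite Cplus_conj, Cmult_conj, I. f_equal.
    + destruct m; simpl; auto. apply injective_projections; simpl; ring.
    + f_equal. apply injective_projections; simpl; ring.
Qed.

Lemma div_lin_mul_lin a f : div_lin a (mul_lin a f) = f.
Proof.
  apply seq_ext; intros n; induction n; simpl; unfold mul_lin, addS, scalS, mul_z in *. ring.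
  rewrite IHn; ring.
Qed.

Lemma mul_lin_mul_mobius a f : mul_lin a (mul_mobius a f) = mul_mobius a (mul_lin a f).
Proof.
  unfold mul_mobius at 2. rewrite div_lin_mul_lin. unfold mul_mobius.
  set (k := div_lin a f). rewrite <- (mul_lin_div_lin a f). fold k.
  apply seq_ext; intros [|[|n]]; unfold mul_lin, addS, scalS, mul_z; ring.
Qed.

(** The coefficient of [z^(n+1)] in [(1 + a z) (phi_a f) = (z + a) f]. For powers of [phi_a] it
    gives a recurrence on a two-by-two block of the matrix, suited to a double induction. *)
Lemma mul_mobius_rec a f n :
  (mul_mobius a f (S n) = f n + RtoC a * f (S n) - RtoC a * mul_mobius a f n)%C.
Proof.
  assert (E := f_equal (fun g => g (S n)) (mul_lin_mul_mobius a f)). unfold mul_mobius at 2 in E.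
  rewrite div_lin_mul_lin in E. unfold mul_lin, addS, scalS, mul_z in E.
  replace (mul_mobius a f (S n)) with (mul_mobius a f (S n) + RtoC a * mul_mobius a f n - RtoC a * mul_mobius a f n)%C by ring.
  rewrite E. ring.
Qed.

Lemma mul_mobius_O a f : (mul_mobius a f O = RtoC a * f O)%C.
Proof. unfold mul_mobius, addS, scalS; simpl; ring. Qed.

Lemma tm_basis_O a m : tm_basis a m O = RtoC (unit_norm a * a ^ m).
Proof.
  induction m. unfold tm_basis, tm0; simpl; auto.
  change (tm_basis a (S m)) with (mul_mobius a (tm_basis a m)). rewrite mul_mobius_O, IHm, <- RtoC_mult.
  f_equal; simpl; ring.
Qed.

(** In matrix form: the transpose of [W] at [a] is [W] at [- a]. Exchanging the indices and the sign
    of [a] leaves the recurrence [mul_mobius_rec] unchanged, and the entries with an index 0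
    agree. *)
Lemma tm_basis_sym a : forall m n, tm_basis a m n = tm_basis (- a) n m.
Proof.
  induction m; intros n.
  - rewrite tm_basis_O, unit_norm_opp. reflexivity.
  - induction n.
    + rewrite tm_basis_O. unfold tm_basis at 1; simpl Nat.iter. unfold tm0. now rewrite unit_norm_opp, Ropp_involutive.
    + change (tm_basis a (S m)) with (mul_mobius a (tm_basis a m)).
      rewrite mul_mobius_rec, !IHm. change (mul_mobius a (tm_basis a m)) with (tm_basis a (S m)). rewrite IHn.
      change (tm_basis (- a) (S n)) with (mul_mobius (- a) (tm_basis (- a) n)).
      rewrite mul_mobius_rec, RtoC_opp. ring.
Qed.

(** The identity [(1 - a^2) / (1 + a z) = 1 - a phi_a(z)]. *)
Lemma tm0_mul_mobius_delta a : Rabs a < 1 ->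
  scalS (RtoC (unit_norm a)) (tm0 a) = addS (scalS (- RtoC a)%C (mul_mobius a (delta 0))) (delta 0).
Proof.
  intros Ha. assert (P := unit_norm_sqr a Ha).
  assert (I : forall n, div_lin a (delta 0) n = RtoC ((- a) ^ n)).
  { induction n; simpl; auto. rewrite IHn. unfold delta; simpl.
    apply injective_projections; simpl; ring. }
  apply seq_ext; intros [|n]; unfold scalS, addS, mul_mobius, tm0, addS, scalS, mul_z.
  - rewrite I. unfold delta; simpl. apply injective_projections; simpl; ring [P].
  - rewrite !I. unfold delta; simpl. apply injective_projections; simpl; ring [P].
Qed.

Lemma tm_basis_mobius_pow a n : Rabs a < 1 ->
  scalS (RtoC (unit_norm a)) (tm_basis a n) = addS (scalS (- RtoC a)%C (mobius_pow a (S n))) (mobius_pow a n).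
Proof.
  intros Ha. induction n. now apply tm0_mul_mobius_delta.
  change (tm_basis a (S n)) with (mul_mobius a (tm_basis a n)).
  change (mobius_pow a (S (S n))) with (mul_mobius a (mobius_pow a (S n))).
  change (mobius_pow a (S n)) with (mul_mobius a (mobius_pow a n)) at 2.
  rewrite <- mul_mobius_linear, <- IHn.
  assert (E : forall c f, mul_mobius a (scalS c f) = scalS c (mul_mobius a f)).
  { intros c f. replace (scalS c f) with (addS (scalS c f) zeroS).
    rewrite mul_mobius_linear, mul_mobius_zero. apply seq_ext; intros; unfold addS, zeroS; ring.
    apply seq_ext; intros; unfold addS, zeroS; ring. }
  now rewrite E.
Qed.

(* This is the matrix form of the duality between [S^2] and [H^2] modulo constants. *)
Lemma mobius_pow_duality a : Rabs a < 1 -> forall n m,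
  (RtoC (INR m) * mobius_pow a n m = RtoC (INR n) * mobius_pow (- a) m n)%C.
Proof.
  intros Ha. assert (Ha' : Rabs (- a) < 1) by now rewrite Rabs_Ropp.
  (* The symmetry of the Takenaka-Malmquist matrix, rewritten in powers of [phi_a] and
     [phi_(-a)]. *)
  assert (G : forall n m, (mobius_pow a n m - RtoC a * mobius_pow a (S n) m =
    mobius_pow (- a) m n + RtoC a * mobius_pow (- a) (S m) n)%C).
  { intros n m. assert (E1 := f_equal (fun f => f m) (tm_basis_mobius_pow a n Ha)).
    assert (E2 := f_equal (fun f => f n) (tm_basis_mobius_pow (- a) m Ha')).
    unfold scalS, addS in E1, E2. rewrite unit_norm_opp, <- tm_basis_sym in E2. rewrite E1 in E2.
    rewrite RtoC_opp in E2.
    transitivity (- RtoC a * mobius_pow a (S n) m + mobius_pow a n m)%C. ring. rewrite E2. ring. }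
  induction n as [|n IHn]; intros m.
  - destruct m; [reflexivity|]. change (mobius_pow a 0 (S m)) with (RtoC 0). change (INR 0) with 0. ring.
  - induction m as [|m IHm].
    + change (mobius_pow (- a) 0 (S n)) with (RtoC 0). change (INR 0) with 0. ring.
    + change (mobius_pow a (S n)) with (mul_mobius a (mobius_pow a n)) at 1.
      rewrite mul_mobius_rec. change (mul_mobius a (mobius_pow a n)) with (mobius_pow a (S n)).
      change (mobius_pow (- a) (S m)) with (mul_mobius (- a) (mobius_pow (- a) m)) at 1.
      rewrite mul_mobius_rec. change (mul_mobius (- a) (mobius_pow (- a) m)) with (mobius_pow (- a) (S m)).
      assert (A1 := IHn m). assert (A2 := IHn (S m)). assert (A3 := IHm). assert (A4 := G n m).
      rewrite !S_INR, !RtoC_plus in *. rewrite !RtoC_opp in *.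
      set (P00 := mobius_pow a n m) in *. set (P01 := mobius_pow a n (S m)) in *.
      set (P10 := mobius_pow a (S n) m) in *. set (Q00 := mobius_pow (- a) m n) in *.
      set (Q10 := mobius_pow (- a) (S m) n) in *. set (Q01 := mobius_pow (- a) m (S n)) in *.
      set (M := RtoC (INR m)) in *. set (N := RtoC (INR n)) in *. set (b := RtoC a) in *.
      (* The recurrence multiplied by [m + 1], arranged so that three terms are covered by induction
         hypotheses; the leftover [P00 - b * P10] is the left side of [G]. *)
      transitivity (M * P00 + b * ((M + 1) * P01) - b * (M * P10) + (P00 - b * P10))%C. ring.
      rewrite A1, A2, A3, A4. ring.
Qed.

Lemma mul_lin_tm_basis a n : mul_lin a (tm_basis a n) = scalS (RtoC (unit_norm a)) (mobius_pow a n).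
Proof.
  induction n. apply mul_lin_tm0.
  change (tm_basis a (S n)) with (mul_mobius a (tm_basis a n)). rewrite mul_lin_mul_mobius, IHn.
  replace (scalS (RtoC (unit_norm a)) (mobius_pow a n)) with
    (addS (scalS (RtoC (unit_norm a)) (mobius_pow a n)) zeroS)
    by (apply seq_ext; intros; unfold addS, zeroS; ring).
  rewrite mul_mobius_linear, mul_mobius_zero. change (mobius_pow a (S n)) with (mul_mobius a (mobius_pow a n)).
  apply seq_ext; intros; unfold addS, zeroS; ring.
Qed.

(** Access to [comp] through its matrix entries, in which the adjoint is computed. Cancelling the
    weight turns the Takenaka-Malmquist functions into powers of [phi_a], and this operation is
    continuous. *)
Lemma comp_coord a g n : Rabs a < 1 -> l2 g ->
  Clim (fun N => fpart (mobius_pow a) g N n) (comp a g n).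
Proof.
  intros Ha Hg. apply (conv_coord (fpart (mobius_pow a) g)). assert (P := unit_norm_pos a Ha).
  assert (Hb := bounded_scal (RtoC (/ unit_norm a)) (mul_lin a) _ (mul_lin_bounded a)).
  apply conv_ext with (fun N => scalS (RtoC (/ unit_norm a)) (mul_lin a (fpart (tm_basis a) g N))).
  - intros N. unfold fpart.
    rewrite (vpart_linear (fun f => scalS (RtoC (/ unit_norm a)) (mul_lin a f))).
    + apply vpart_ext. intros k. rewrite mul_lin_scal, mul_lin_tm_basis.
      apply seq_ext; intros m. unfold scalS. rewrite RtoC_inv by lra. field. apply RtoC_neq_0; lra.
    + apply Hb.
    + intros; apply l2_scal; now apply tm_basis_l2.
  - apply (conv_bounded (fun f => scalS (RtoC (/ unit_norm a)) (mul_lin a f)) _ _ _ Hb).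
    + intros; apply l2_fpart; intros; now apply tm_basis_l2.
    + apply synthesis_conv; auto. now apply tm_basis_bessel.
Qed.

Lemma Clim_components u l : Clim u l ->
  is_lim_seq (fun n => fst (u n)) (fst l) /\ is_lim_seq (fun n => snd (u n)) (snd l).
Proof.
  intros H. split; apply is_lim_seq_spec; intros [e He]; destruct (H (e / 2)) as [N HN]; try lra;
  exists N; intros n Hn; specialize (HN n Hn); simpl;
  (eapply Rle_lt_trans; [|apply Rle_lt_trans with (1 := HN); lra]).
  apply (Cmod_fst_le (u n - l)%C). apply (Cmod_snd_le (u n - l)%C).
Qed.

Lemma comp_series a g n : Rabs a < 1 -> l2 g ->
  is_series (fun m => fst (g m * mobius_pow a m n)%C) (fst (comp a g n)) /\
  is_series (fun m => snd (g m * mobius_pow a m n)%C) (snd (comp a g n)).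
Proof.
  intros Ha Hg. destruct (Clim_components _ _ (comp_coord a g n Ha Hg)) as [H1 H2].
  apply is_lim_seq_incr_1 in H1. apply is_lim_seq_incr_1 in H2.
  assert (E : forall N, fst (fpart (mobius_pow a) g (S N) n) = sum_n (fun m => fst (g m * mobius_pow a m n)%C) N
    /\ snd (fpart (mobius_pow a) g (S N) n) = sum_n (fun m => snd (g m * mobius_pow a m n)%C) N).
  { induction N as [|N [I1 I2]].
    - rewrite !sum_n_0. unfold fpart; simpl. unfold addS, scalS, zeroS; simpl. split; ring.
    - rewrite !sum_n_S, <- I1, <- I2. split; reflexivity. }
  split.
  - apply (is_lim_seq_ext _ _ _ (fun N => proj1 (E N)) H1).
  - apply (is_lim_seq_ext _ _ _ (fun N => proj2 (E N)) H2).
Qed.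

(** * Identification of S^2 with l^2, and the adjoint *)

(** The isometry [f |-> f(0) + z f'] of [S^2] onto [H^2]. *)
Definition to_H2 (a : seqC) : seqC := fun n => match n with O => a O | S _ => (RtoC (INR n) * a n)%C end.
Definition of_H2 (f : seqC) : seqC := fun n => match n with O => f O | S _ => (/ RtoC (INR n) * f n)%C end.

Lemma INR_S_neq n : RtoC (INR (S n)) <> 0.
Proof. apply RtoC_neq_0. apply not_0_INR. lia. Qed.

Lemma to_H2_of_H2 f : to_H2 (of_H2 f) = f.
Proof.
  apply seq_ext; intros [|n]; unfold to_H2, of_H2; auto. field. apply INR_S_neq.
Qed.
Lemma of_H2_to_H2 f : of_H2 (to_H2 f) = f.
Proof.
  apply seq_ext; intros [|n]; unfold to_H2, of_H2; auto. field. apply INR_S_neq.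
Qed.

Lemma to_H2_add f g : to_H2 (addS f g) = addS (to_H2 f) (to_H2 g).
Proof. apply seq_ext; intros [|n]; unfold to_H2, addS; ring. Qed.
Lemma to_H2_scal c f : to_H2 (scalS c f) = scalS c (to_H2 f).
Proof. apply seq_ext; intros [|n]; unfold to_H2, scalS; ring. Qed.
Lemma to_H2_sub f g : to_H2 (subS f g) = subS (to_H2 f) (to_H2 g).
Proof. apply seq_ext; intros [|n]; unfold to_H2, subS; ring. Qed.
Lemma of_H2_add f g : of_H2 (addS f g) = addS (of_H2 f) (of_H2 g).
Proof. apply seq_ext; intros [|n]; unfold of_H2, addS; ring. Qed.
Lemma of_H2_scal c f : of_H2 (scalS c f) = scalS c (of_H2 f).
Proof. apply seq_ext; intros [|n]; unfold of_H2, scalS; ring. Qed.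
Lemma to_H2_weight a n : Cmod (to_H2 a n) ^ 2 = wS2 n * Cmod (a n) ^ 2.
Proof.
  destruct n; unfold to_H2, wS2. ring.
  rewrite Cmod_mult, Cmod_R, Rabs_pos_eq by apply pos_INR. ring.
Qed.

Lemma l2_of_ex_series f : ex_series (fun n => Cmod (f n) ^ 2) -> l2 f.
Proof.
  intros H. set (t := Series (fun n => Cmod (f n) ^ 2)).
  assert (Hle : forall N, sum_n (fun n => Cmod (f n) ^ 2) N <= t).
  { intros N. apply (sum_le_Series (fun n => Cmod (f n) ^ 2)); auto. intros; apply pow2_ge_0. }
  exists (sqrt t). split. apply sqrt_pos. intros N. rewrite pow2_sqrt; auto.
  eapply Rle_trans; [|apply (Hle O)]. rewrite sum_n_0. apply pow2_ge_0.
Qed.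

Lemma inS2_to_H2 a : inS2 a <-> l2 (to_H2 a).
Proof.
  split; intros H.
  - apply l2_of_ex_series. eapply ex_series_ext; [|apply H]. intros n. symmetry; apply to_H2_weight.
  - eapply ex_series_ext; [|apply (l2_ex_series _ H)]. intros n. apply to_H2_weight.
Qed.

Lemma inS2_of_H2 f : l2 f -> inS2 (of_H2 f).
Proof. intros H. apply inS2_to_H2. now rewrite to_H2_of_H2. Qed.

Lemma normS2_to_H2 a : normS2 a = sqrt (normsq (to_H2 a)).
Proof.
  unfold normS2, normsq. f_equal. apply Series_ext. intros n. now rewrite to_H2_weight.
Qed.

Lemma to_H2_coef_bounded a : coef_bounded (to_H2 a) -> coef_bounded a.
Proof.
  intros [B H]. exists B. intros n. apply Rle_trans with (2 := H n).
  destruct n; unfold to_H2. lra.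
  rewrite Cmod_mult, Cmod_R, Rabs_pos_eq by apply pos_INR.
  assert (P := Cmod_ge_0 (a (S n))). assert (1 <= INR (S n)) by (rewrite S_INR; assert (Q := pos_INR n); lra).
  nra.
Qed.

Lemma to_H2_delta_scal n : to_H2 (delta n) = scalS (to_H2 (delta n) n) (delta n).
Proof.
  apply seq_ext; intros k. unfold scalS. destruct (Nat.eq_dec k n) as [->|H].
  - unfold delta at 3. rewrite Nat.eqb_refl. ring.
  - unfold delta at 3. destruct (Nat.eqb_spec k n); [contradiction|].
    unfold to_H2, delta. destruct k; destruct (Nat.eqb_spec 0 n); try contradiction;
    destruct (Nat.eqb_spec (S k) n) || idtac; try contradiction; ring.
Qed.

Lemma inS2_delta n : inS2 (delta n).
Proof. apply inS2_to_H2. rewrite to_H2_delta_scal. apply l2_scal, l2_delta. Qed.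

Lemma Cpow_RtoC x n : Cpow (RtoC x) n = RtoC (x ^ n).
Proof. symmetry. apply RtoC_pow. Qed.

Lemma phi_real r x : Rabs r < 1 -> Rabs x < 1 -> phi r (RtoC x) = RtoC (mobius r x).
Proof.
  intros Hr Hx. assert (D := mobius_den r x Hr Hx). unfold phi, mobius.
  rewrite RtoC_div by lra. now rewrite !RtoC_plus, RtoC_mult.
Qed.

(** [is_comp_op] speaks of values. For a monomial the input series is finite with sum [phi^n], and
    agreement at real points fixes the coefficients of the image. *)
Lemma comp_op_delta r Cop n : Rabs r < 1 -> is_comp_op r Cop -> Cop (delta n) = mobius_pow r n.
Proof.
  intros Hr HC. destruct (HC (delta n) (inS2_delta n)) as [H1 H2].
  apply eval_inj.
  - apply to_H2_coef_bounded, l2_coef_bounded. now apply inS2_to_H2.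
  - apply l2_coef_bounded. now apply mobius_pow_l2.
  - intros x Hx. rewrite eval_mobius_pow by auto.
    assert (Hx' : Cmod (RtoC x) < 1) by now rewrite Cmod_R.
    assert (S := H2 _ Hx' _ (is_series_delta n (fun k => Cpow (phi r (RtoC x)) k))).
    cbv beta in S. rewrite phi_real, Cpow_RtoC in S by auto.
    apply is_series_C_components in S as [S1 S2].
    unfold eval, PSeries. apply injective_projections; simpl fst; simpl snd.
    + rewrite <- (is_series_unique _ (mobius r x ^ n) S1). apply Series_ext. intros k.
      rewrite Cpow_RtoC. simpl; ring.
    + change (Series (fun k => snd (Cop (delta n) k) * x ^ k) = 0).
      rewrite <- (is_series_unique _ 0 S2). apply Series_ext. intros k.
      rewrite Cpow_RtoC. simpl; ring.
Qed.

(** The solution [f] of [z f' = g - g(0)] with [f(0) = 0], whose kernel is the constants. *)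
Definition S2_of_H2 (g : seqC) : seqC := of_H2 (drop0 g).

Lemma inner_delta n (v : nat -> C) :
  (Series (fun k => fst (delta n k * v k)%C), Series (fun k => snd (delta n k * v k)%C)) = v n.
Proof.
  destruct (is_series_C_components _ _ (is_series_delta n v)) as [H1 H2].
  rewrite (is_series_unique _ _ H1), (is_series_unique _ _ H2). now destruct (v n).
Qed.

(** Tested against monomials. The weight [k^2] and the divisor [k] leave a factor [k], which
    [mobius_pow_duality] trades for [n]; the remaining sum over [k] is a coordinate of
    [comp (- r) g]. *)
Lemma adjoint_S2_of_H2 r Cop A g : Rabs r < 1 -> is_comp_op r Cop -> is_adjoint Cop A -> l2 g ->
  A (S2_of_H2 g) = S2_of_H2 (comp (- r) g).
Proof.
  intros Hr HC [HA1 HA2] Hg. assert (Hr' : Rabs (- r) < 1) by now rewrite Rabs_Ropp.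
  assert (HP : inS2 (S2_of_H2 g)).
  { apply inS2_of_H2. destruct Hg as [B HB]. exists B. now apply drop0_normle. }
  assert (HAP := HA1 _ HP).
  apply seq_ext; intros n.
  assert (E := HA2 (delta n) (S2_of_H2 g) (inS2_delta n) HP).
  rewrite (comp_op_delta r Cop n Hr HC) in E.
  assert (ER : ipS2 (delta n) (A (S2_of_H2 g)) = (RtoC (wS2 n) * Cconj (A (S2_of_H2 g) n))%C).
  { rewrite <- (inner_delta n (fun k => (RtoC (wS2 k) * Cconj (A (S2_of_H2 g) k))%C)).
    unfold ipS2. apply injective_projections; simpl fst; simpl snd;
    apply Series_ext; intros k; simpl; ring. }
  destruct (comp_series (- r) g n Hr' Hg) as [K1 K2].
  assert (EL : ipS2 (mobius_pow r n) (S2_of_H2 g) = (RtoC (INR n) * Cconj (comp (- r) g n))%C).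
  { assert (T : forall k, (RtoC (wS2 k) * (mobius_pow r n k * Cconj (S2_of_H2 g k)))%C =
      (RtoC (INR n) * Cconj (g k * mobius_pow (- r) k n))%C).
    { intros k. rewrite Cmult_conj, real_mobius_pow.
      transitivity (RtoC (INR k) * mobius_pow r n k * Cconj (g k))%C.
      - destruct k; unfold wS2, S2_of_H2, of_H2, drop0.
        + replace (Cconj 0) with (RtoC 0) by (apply injective_projections; simpl; ring).
          simpl INR. ring.
        + assert (N := INR_S_neq k).
          rewrite Cmult_conj.
          replace (Cconj (/ RtoC (INR (S k)))) with (/ RtoC (INR (S k)))%C.
          2:{ rewrite <- RtoC_inv. apply injective_projections; simpl; ring.
              apply not_0_INR; lia. }
          rewrite RtoC_pow. set (i := RtoC (INR (S k))) in *. simpl Cpow. field. auto.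
      - rewrite mobius_pow_duality by auto. ring. }
    unfold ipS2. apply injective_projections.
    - transitivity (INR n * fst (comp (- r) g n)); [|simpl; ring].
      rewrite <- (is_series_unique _ _ K1), <- Series_scal_l.
      apply Series_ext. intros k. rewrite T. simpl; ring.
    - transitivity (- INR n * snd (comp (- r) g n)); [|simpl; ring].
      rewrite <- (is_series_unique _ _ K2), <- Series_scal_l.
      apply Series_ext. intros k. rewrite T. simpl; ring. }
  rewrite ER, EL in E.
  assert (E' := f_equal Cconj E). rewrite !Cmult_conj, !Cconj_conj in E'.
  assert (CR : forall x, Cconj (RtoC x) = RtoC x) by (intros; apply injective_projections; simpl; ring).
  rewrite !CR in E'.
  (* At index 0 the weight is 1 while the factor on the other side is [INR 0], so the coefficient
     vanishes. At other indices [n^2] against [n] leaves the division by [n]. *)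
  set (t := A (S2_of_H2 g) n) in *. clearbody t. clear - E'. destruct n; unfold wS2 in E'.
  - change (t = RtoC 0). change (INR 0) with 0 in E'.
    replace t with (1 * t)%C by ring. rewrite <- E'. ring.
  - assert (N := INR_S_neq n).
    change (t = / RtoC (INR (S n)) * comp (- r) g (S n))%C. rewrite RtoC_pow in E'.
    set (k := comp (- r) g (S n)) in *. set (i := RtoC (INR (S n))) in *. simpl Cpow in E'.
    replace k with (/ i * (i * k))%C by (field; auto).
    rewrite E'. field. auto.
Qed.

(** * Universality on S^2 *)

Theorem theorem3p2 (r : R) (Cop A : op) (lam : C) :
  0 < r < 1 ->
  is_comp_op r Cop ->
  is_adjoint Cop A ->
  sqrt ((1 - r) / (1 + r)) < Cmod lam < / sqrt ((1 - r) / (1 + r)) ->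
  universal (shift_op A lam).
Proof.
  intros Hr HC HA Hlam T (HT1 & HT2 & HT3 & KT & HT4).
  assert (Ar : Rabs r < 1) by (rewrite Rabs_pos_eq; lra).
  assert (nbS : forall a, inS2 a -> normle (to_H2 a) (normS2 a)).
  { intros a Ha. rewrite normS2_to_H2. now apply normle_normsq, inS2_to_H2. }
  assert (nbS' : forall a B, normle (to_H2 a) B -> normS2 a <= B).
  { intros a B H. rewrite normS2_to_H2. now apply sqrt_normsq_le. }
  (* [T] is transported to [l^2]. The absolute value is taken because the given bound [KT] carries
     no sign condition. *)
  assert (HTb : bounded_l2 (fun f => to_H2 (T (of_H2 f))) (Rabs KT)).
  { split; [split|split].
    - intros f g Hf Hg. now rewrite of_H2_add, HT2, to_H2_add by (now apply inS2_of_H2).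
    - intros c f Hf. now rewrite of_H2_scal, HT3, to_H2_scal by (now apply inS2_of_H2).
    - apply Rabs_pos.
    - intros f B Hf. assert (Hi : inS2 (of_H2 f)) by (apply inS2_of_H2; now exists B).
      eapply normle_mono. apply nbS; auto. eapply Rle_trans. now apply HT4.
      assert (N0 : 0 <= normS2 (of_H2 f)) by apply sqrt_pos.
      apply Rle_trans with (Rabs KT * normS2 (of_H2 f)).
      apply Rmult_le_compat_r; auto. apply Rle_abs.
      apply Rmult_le_compat_l. apply Rabs_pos. apply nbS'. now rewrite to_H2_of_H2. }
  assert (Hlam' : kap r < Cmod (Cconj lam) < / kap r) by (rewrite Cmod_conj; exact Hlam).
  destruct (hardy_model r (Cconj lam) _ _ Hr Hlam' HTb) as (c & X & KX & Hc & HX & HU & HL).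
  set (Y := fun f => S2_of_H2 (X f)).
  assert (Xl2 : forall f, l2 f -> l2 (X f)) by (intros f; now apply bounded_maps_l2 with KX).
  assert (Xb : forall f B, normle f B -> normle (X f) (KX * B)) by apply HX.
  assert (HK : 0 <= KX) by apply HX.
  assert (Dl2 : forall g, l2 g -> l2 (drop0 g)).
  { intros g [B HB]. exists B. now apply drop0_normle. }
  assert (Pi_add : forall f g, S2_of_H2 (addS f g) = addS (S2_of_H2 f) (S2_of_H2 g)).
  { intros; apply seq_ext; intros [|n]; unfold S2_of_H2, of_H2, drop0, addS; ring. }
  assert (Pi_scal : forall d f, S2_of_H2 (scalS d f) = scalS d (S2_of_H2 f)).
  { intros; apply seq_ext; intros [|n]; unfold S2_of_H2, of_H2, drop0, scalS; ring. }
  assert (Pi_sub : forall f g, S2_of_H2 (subS f g) = subS (S2_of_H2 f) (S2_of_H2 g)).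
  { intros; apply seq_ext; intros [|n]; unfold S2_of_H2, of_H2, drop0, subS; ring. }
  assert (Yadd : forall f g, l2 f -> l2 g -> Y (addS f g) = addS (Y f) (Y g)).
  { intros f g Hf Hg. unfold Y. now rewrite (proj1 (proj1 HX)), Pi_add. }
  assert (Yscal : forall d f, l2 f -> Y (scalS d f) = scalS d (Y f)).
  { intros d f Hf. unfold Y. now rewrite (proj2 (proj1 HX)), Pi_scal. }
  assert (Ysub : forall f g, l2 f -> l2 g -> Y (subS f g) = subS (Y f) (Y g)).
  { intros f g Hf Hg. unfold Y. rewrite (linear_sub X), Pi_sub; auto. apply HX. }
  assert (YS : forall f, l2 f -> inS2 (Y f)).
  { intros f Hf. apply inS2_of_H2, Dl2, Xl2, Hf. }
  assert (YL : forall f B, l2 f -> normle (to_H2 (Y f)) B -> normle f (2 * B)).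
  { intros f B Hf H. apply HL; auto. unfold Y, S2_of_H2 in H. now rewrite to_H2_of_H2 in H. }
  assert (Yinj : forall f g, l2 f -> l2 g -> Y f = Y g -> f = g).
  { intros f g Hf Hg E. assert (Z : subS f g = zeroS).
    { apply normle_0_eq. replace 0 with (2 * 0) by ring. apply YL. now apply l2_sub.
      rewrite Ysub, E by auto. replace (to_H2 (subS (Y g) (Y g))) with zeroS. apply normle_zero.
      apply seq_ext; intros [|n]; unfold to_H2, subS, zeroS; ring. }
    apply seq_ext; intros n. apply (f_equal (fun h => h n)) in Z. unfold subS, zeroS in Z.
    replace (f n) with (f n - g n + g n)%C by ring. rewrite Z; ring. }
  (* The invariant subspace is the range of [Y]; [inv] is the inverse of [Y] on it, well defined by
     injectivity. *)
  set (M := fun b => exists f, l2 f /\ b = Y f).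
  set (inv := fun b => epsilon (inhabits zeroS) (fun f => l2 f /\ b = Y f)).
  assert (Hinv : forall f, l2 f -> inv (Y f) = f).
  { intros f Hf. assert (H : exists g, l2 g /\ Y f = Y g) by now exists f.
    assert (G := epsilon_spec (inhabits zeroS) (fun g => l2 g /\ Y f = Y g) H).
    destruct G as [G1 G2]. symmetry. now apply Yinj. }
  assert (HUY : forall f, l2 f ->
    shift_op A lam (Y f) = Y (scalS c (to_H2 (T (of_H2 f))))).
  { intros f Hf. unfold shift_op, Y.
    rewrite (adjoint_S2_of_H2 r Cop A) by auto.
    rewrite <- Pi_scal, <- Pi_sub, HU by auto.
    rewrite (proj2 (proj1 HX)); auto. apply (bounded_maps_l2 _ _ _ HTb Hf). }
  assert (HTl2 : forall f, l2 f -> l2 (to_H2 (T (of_H2 f)))).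
  { intros f Hf. apply (bounded_maps_l2 _ _ _ HTb Hf). }
  exists M, c, (fun b => of_H2 (inv b)).
  split; [auto|]. split; [|split; [|split]].
  - split; [|split; [|split; [|split]]].
    + intros a (f & Hf & ->). auto.
    + exists zeroS. split. apply l2_zero. unfold Y. rewrite linear_zero by apply HX.
      apply seq_ext; intros [|n]; unfold S2_of_H2, of_H2, drop0, zeroS; ring.
    + intros a b (f & Hf & ->) (g & Hg & ->). exists (addS f g). split.
      now apply l2_add. now rewrite Yadd.
    + intros d a (f & Hf & ->). exists (scalS d f). split. now apply l2_scal. now rewrite Yscal.
    + intros u a Hu Ha Hlim.
      set (s := fun k => inv (u k)).
      assert (Hs : forall k, l2 (s k) /\ u k = Y (s k)).
      { intros k. apply (epsilon_spec (inhabits zeroS) (fun f => l2 f /\ u k = Y f) (Hu k)). }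
      assert (Hconv : conv (fun k => to_H2 (u k)) (to_H2 a)).
      { apply conv_of_tail with (1 := Hlim). intros n. rewrite <- to_H2_sub.
        apply nbS. apply inS2_to_H2. rewrite to_H2_sub. apply l2_sub; apply inS2_to_H2; auto.
        rewrite (proj2 (Hs n)). apply YS, Hs. }
      assert (Hc' : cauchy_normle s).
      (* Closedness rests on the lower bound [YL]: its factor 2 and the triangle inequality turn
         [e / 4] into [e], so the preimages form a Cauchy sequence. *)
      { intros e He. destruct (Hconv (e / 4)) as [N HN]; [lra|]. exists N. intros n m Hn Hm.
        replace e with (2 * (e / 4 + e / 4)) by field.
        apply YL. apply l2_sub; apply Hs.
        rewrite Ysub, <- (proj2 (Hs n)), <- (proj2 (Hs m)), to_H2_sub by apply Hs.
        replace (subS (to_H2 (u n)) (to_H2 (u m))) with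
          (subS (subS (to_H2 (u n)) (to_H2 a)) (subS (to_H2 (u m)) (to_H2 a)))
          by (apply seq_ext; intros; unfold subS; ring).
        apply normle_sub; auto. }
      assert (Cs := cauchy_conv s Hc'). set (l := coord_lim s) in *.
      assert (Hl : l2 l) by (apply (conv_l2 s); auto; intros; apply Hs).
      exists l. split; auto.
      rewrite <- (of_H2_to_H2 a). unfold Y, S2_of_H2. f_equal.
      apply conv_unique with (fun k => to_H2 (u k)); auto.
      assert (HD : bounded_l2 (fun f => drop0 (X f)) KX).
      { split; [split|split]; auto.
        - intros f g Hf Hg. rewrite (proj1 (proj1 HX)); auto.
          apply seq_ext; intros [|n]; unfold drop0, addS; ring.
        - intros d f Hf. rewrite (proj2 (proj1 HX)); auto.
          apply seq_ext; intros [|n]; unfold drop0, scalS; ring.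
        - intros f B Hf. apply drop0_normle. now apply Xb. }
      eapply conv_ext; [|apply (conv_bounded _ _ s l HD)]; auto; [|intros; apply Hs].
      intros n. simpl. rewrite (proj2 (Hs n)). unfold Y, S2_of_H2. now rewrite to_H2_of_H2.
  - intros a (f & Hf & ->). rewrite HUY by auto.
    exists (scalS c (to_H2 (T (of_H2 f)))). split; auto. apply l2_scal; auto.
  - split; [|split; [|split; [|split; [|split]]]].
    + intros a (f & Hf & ->). rewrite Hinv by auto. now apply inS2_of_H2.
    + intros a b (f & Hf & ->) (g & Hg & ->).
      rewrite <- Yadd, !Hinv, of_H2_add; auto. now apply l2_add.
    + intros d a (f & Hf & ->). rewrite <- Yscal, !Hinv, of_H2_scal; auto. now apply l2_scal.
    + exists 2. intros a (f & Hf & ->). rewrite Hinv by auto. apply nbS'. rewrite to_H2_of_H2.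
      apply YL; auto.
    (* The lower bound for the inverse of [Y] is the upper bound for [Y]; adding 1 covers
       [KX = 0]. *)
    + exists (/ (KX + 1)). split. apply Rinv_0_lt_compat; lra.
      intros a (f & Hf & ->). rewrite Hinv by auto.
      assert (Hn : normle f (normS2 (of_H2 f))).
      { rewrite <- (to_H2_of_H2 f) at 1. apply nbS. now apply inS2_of_H2. }
      assert (H1 : normS2 (Y f) <= KX * normS2 (of_H2 f)).
      { apply nbS'. unfold Y, S2_of_H2. rewrite to_H2_of_H2. now apply drop0_normle, Xb. }
      assert (N0 := proj1 Hn).
      apply Rmult_le_reg_l with (KX + 1); [lra|].
      rewrite <- Rmult_assoc, Rinv_r, Rmult_1_l by lra. lra.
    + intros b Hb. exists (Y (to_H2 b)). assert (Hl : l2 (to_H2 b)) by now apply inS2_to_H2.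
      split. now exists (to_H2 b). rewrite Hinv by auto. apply of_H2_to_H2.
  - intros a (f & Hf & ->). rewrite HUY, !Hinv, of_H2_scal, of_H2_to_H2; auto. now apply l2_scal, HTl2.
Qed.
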